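(* Let $\gamma>0$, $0\le\alpha\le\beta$, $\mu>0$, $r\in\mathbb{N}$, and let $f\in C_\mu[0,\infty)$ be such that $f^{(r)}$ exists at a point $x\in(0,\infty)$. Then $$\lim_{n\to\infty}\frac{d^r}{dx^r}B_{n,\gamma}^{\alpha,\beta}(f,x)=f^{(r)}(x).$$
   Context: $C_\mu[0,\infty)=\{f\in C[0,\infty): |f(t)|\le Mt^{\mu}\text{ for some }M>0\}$. For $\gamma>0$, $n\in\mathbb{N}$, $k\in\mathbb{N}\cup\{0\}$, $x,t\in[0,\infty)$ let $$p_{n,k,\gamma}(x)=\frac{\Gamma(n/\gamma+k)}{\Gamma(k+1)\Gamma(n/\gamma)}\cdot\frac{(\gamma x)^k}{(1+\gamma x)^{n/\gamma+k}},\qquad b_{n,k,\gamma}(t)=\frac{\gamma\,\Gamma(n/\gamma+k+1)}{\Gamma(k)\Gamma(n/\gamma+1)}\cdot\frac{(\gamma t)^{k-1}}{(1+\gamma t)^{n/\gamma+k+1}}\ (k\ge1).$$ For $0\le\alpha\le\beta$ the Baskakov–Durrmeyer–Stancu operator is $$B_{n,\gamma}^{\alpha,\beta}(f,x)=\sum_{k=1}^{\infty}p_{n,k,\gamma}(x)\int_0^\infty b_{n,k,\gamma}(t)f\left(\frac{nt+\alpha}{n+\beta}\right)dt+p_{n,0,\gamma}(x)f\left(\frac{\alpha}{n+\beta}\right).$$ *)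

(* Defs.v *)
From Stdlib Require Import Reals.
From Coquelicot Require Import Coquelicot.
Open Scope R_scope.

Definition Gamma (s : R) : R :=
  RInt_gen (fun t => Rpower t (s - 1) * exp (- t))
           (at_right 0) (Rbar_locally p_infty).

Definition p_nkg (n k : nat) (g x : R) : R :=
  Gamma (INR n / g + INR k) / (Gamma (INR k + 1) * Gamma (INR n / g))
  * ((g * x) ^ k / Rpower (1 + g * x) (INR n / g + INR k)).

(* b_{n,k,gamma}(t), for k >= 1 *)
Definition b_nkg (n k : nat) (g t : R) : R :=
  g * Gamma (INR n / g + INR k + 1) / (Gamma (INR k) * Gamma (INR n / g + 1))
  * ((g * t) ^ (k - 1) / Rpower (1 + g * t) (INR n / g + INR k + 1)).

(* Baskakov-Durrmeyer-Stancu operator B_{n,gamma}^{alpha,beta}(f, x):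
   sum over k >= 1 (reindexed k = S j) plus the k = 0 term. *)
Definition BDS (n : nat) (g a b : R) (f : R -> R) (x : R) : R :=
  Series (fun j =>
    p_nkg n (S j) g x *
    RInt_gen (fun t => b_nkg n (S j) g t * f ((INR n * t + a) / (INR n + b)))
             (at_point 0) (Rbar_locally p_infty))
  + p_nkg n 0 g x * f (a / (INR n + b)).

(* "f^(r)(x) exists and equals l": for r = S r', there are functions
   g 0 = f, g 1, ..., g r' with g (j+1) the derivative of g j on a
   neighbourhood of x (j < r'), and g r' differentiable at x with
   derivative l.  For r = 0 this just says f x = l. *)
Definition rth_derivative_at (f : R -> R) (r : nat) (x l : R) : Prop :=
  match r with
  | O => f x = l
  | S r' => exists (g : nat -> R -> R) (d : posreal),
      g O = f /\
      (forall (j : nat) (y : R), (j < r')%nat -> Rabs (y - x) < d ->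
          is_derive (g j) y (g (S j) y)) /\
      is_derive (g r') x l
  end.

Definition cont_on_halfline (f : R -> R) : Prop :=
  forall t, 0 <= t ->
    filterlim f (within (fun u => 0 <= u) (locally t)) (locally (f t)).

Definition C_mu (mu : R) (f : R -> R) : Prop :=
  cont_on_halfline f /\
  exists M, 0 < M /\ forall t, 0 < t -> Rabs (f t) <= M * Rpower t mu.

(* Main.v *)
(* With c = n/g, the numbers p_{n,k}(y) form a negative binomial distribution in k, and
   y (1 + g y) p_k' = (k - n y) p_k.  Differentiating this equation r times gives a three-term
   recurrence, hence  |p_k^(r)(x)| <= C q^r (1 + |k - n x| / q)^r p_k(x)  with q = sqrt n.
   Likewise (t (1 + g t) b_k)' = (k - n t) b_k gives a recurrence for the moments of b_k about a
   point y near x: they are O(q^-m (1 + |k - n x| / q)^m), and they are polynomials of degree m in k,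
   so that the r-th derivative of the operator kills the moments of order < r and sends the one of
   order r to  r! prod_{j<r} (n + j g) / (n - j g).  Exponential moments of the negative binomial
   distribution bound the mean of every power of 1 + |k - n x| / q uniformly in n.
   Now write f as its Taylor polynomial at x plus a remainder bounded, for every eps, by
   eps |t - x|^r + C (t - x)^(2p) with 2p > r.  The polynomial contributes f^(r)(x) in the limit and
   the remainder at most a constant times eps + C / q. *)
Require Import Defs.
From Stdlib Require Import Reals.
From Coquelicot Require Import Coquelicot.
From Stdlib Require Import Lra Lia Psatz Factorial.
Open Scope R_scope.

(** * Improper integrals and the Gamma function *)

(** Since f^(r) is known at the single point x, no derivative may fall on f: all r of them fall on
    the weights p_k, and the loss of q^r has to be recovered from the smallness of the Taylor
    remainder. This is why the operator is treated as the mean of an arbitrary sequence in k, of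
    which only polynomial growth is known. The Stancu parameters are absorbed by an affine change:
    (n t + a)/(n + b) - x = ka (t - y) with ka = n/(n + b) and y = x + (b x - a)/n, so moments are
    taken about y. That centre stays fixed while the mean is differentiated in its own variable, so
    the two variables are kept apart throughout. The recurrence gives powers of t - y, not absolute
    values; positivity of the weight functionals and even exponents take the place of absolute
    moments. *)

Lemma pow_le_fact_exp (m : nat) (y : R) : 0 <= y -> y ^ m <= INR (fact m) * exp y.
Proof.
  intros Hy.
  assert (Hf : 0 < INR (fact m)) by apply INR_fact_lt_0.
  assert (H : / INR (fact m) * y ^ m <= exp y).
  { assert (He := is_exp_Reals y). apply is_pseries_R in He.
    rewrite <- (is_series_unique _ _ He).
    assert (Hpos : forall k, 0 <= / INR (fact k) * y ^ k).
    { intros k. apply Rmult_le_pos; [left; apply Rinv_0_lt_compat,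
        INR_fact_lt_0 | now apply pow_le]. }
    transitivity (sum_f_R0 (fun k => / INR (fact k) * y ^ k) m).
    - destruct m as [|m]; [simpl; lra|].
      rewrite tech5.
      assert (0 <= sum_f_R0 (fun k => / INR (fact k) * y ^ k) m) by (apply cond_pos_sum; auto).
      lra.
    - rewrite (Series_incr_n _ (S m)); [simpl pred | lia | eexists; apply He].
      assert (0 <= Series (fun k => / INR (fact (S m + k)) * y ^ (S m + k))); [|lra].
      rewrite <- (Rmult_0_l (Series (fun k => 0))), <- Series_scal_l.
      apply Series_le; [intros k; specialize (Hpos (S m + k)%nat); lra|].
      apply -> (ex_series_incr_n (fun k => / INR (fact k) * y ^ k) (S m)). eexists; apply He. }
  replace (y ^ m) with (INR (fact m) * (/ INR (fact m) * y ^ m)) by (field; lra).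
  apply Rmult_le_compat_l; lra.
Qed.

Lemma is_RInt_inv_sqr (K u v : R) :
  0 <= u -> 0 <= v -> is_RInt (fun t => K / (1 + t) ^ 2) u v (K / (1 + u) - K / (1 + v)).
Proof.
  intros Hu Hv.
  replace (K / (1 + u) - K / (1 + v)) with (minus ((fun t => - K / (1 + t)) v) ((fun t => - K /
      (1 + t)) u))
    by (unfold minus, plus, opp; simpl; field; lra).
  assert (Hm : forall z, Rmin u v <= z -> 0 <= z) by (intros z; apply Rmin_case; lra).
  apply (is_RInt_derive (V := R_CompleteNormedModule) (fun t => - K / (1 + t)) (fun t => K / (1 +
      t) ^ 2) u v).
  - intros z [Hz _]. specialize (Hm z Hz). auto_derive; [lra | field; lra].
  - intros z [Hz _]. specialize (Hm z Hz).
    apply (ex_derive_continuous (fun t => K / (1 + t) ^ 2)). auto_derive. nra.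
Qed.

(** The majorant K/(1+t)^2 is chosen for its explicit primitive. The upward closed set P stands for
    (0, oo) or [0, oo), according to the lower end of the integral. *)
Lemma RInt_dominated_inv_sqr (P : R -> Prop) (f : R -> R) (K : R) :
  (forall s t, P s -> s <= t -> P t) -> (forall t, P t -> 0 <= t) ->
  (forall s t, P s -> P t -> ex_RInt f s t) ->
  (forall t, P t -> Rabs (f t) <= K / (1 + t) ^ 2) ->
  forall s t, P s -> P t -> Rabs (RInt f s t) <= Rabs (K / (1 + s) - K / (1 + t)).
Proof.
  intros Hup Hpos Hex Hb.
  assert (H : forall s t, P s -> P t -> s <= t -> Rabs (RInt f s t) <= Rabs (K / (1 + s) - K / (1
      + t))).
  { intros s t Hs Ht Hst. eapply Rle_trans; [|apply Rle_abs].
    apply (norm_RInt_le f (fun t => K / (1 + t) ^ 2) s t (RInt f s t)); auto.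
    - intros z Hz. apply Hb. apply Hup with s; tauto.
    - apply (RInt_correct (V := R_CompleteNormedModule)). auto.
    - apply is_RInt_inv_sqr; auto. }
  intros s t Hs Ht. destruct (Rle_lt_dec s t) as [h|h]; [auto|].
  rewrite <- (opp_RInt_swap (V := R_CompleteNormedModule)) by auto.
  rewrite <- (Rabs_Ropp (_ - _)). unfold opp; simpl. rewrite Rabs_Ropp.
  replace (- (K / (1 + s) - K / (1 + t))) with (K / (1 + t) - K / (1 + s)) by ring.
  apply H; auto; lra.
Qed.

(** Cauchy criterion in both endpoints at once: moving them changes the integral by at most the
    change of K/(1+t), which is small near 0 and near infinity. The filter Fa is left general to
    serve [at_right 0] for [Gamma] and [at_point 0] for the weights. *)
Lemma ex_RInt_gen_dominated (Fa : (R -> Prop) -> Prop) (PF : ProperFilter Fa)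
    (P : R -> Prop) (f : R -> R) (K : R) :
  Fa P -> (forall eps : posreal, Fa (fun s => s < eps)) ->
  (forall s t, P s -> s <= t -> P t) -> (forall t, P t -> 0 <= t) ->
  (forall s t, P s -> P t -> ex_RInt f s t) ->
  (forall t, P t -> Rabs (f t) <= K / (1 + t) ^ 2) ->
  ex_RInt_gen f Fa (Rbar_locally p_infty).
Proof.
  intros HP Hsm Hup Hpos Hex Hb.
  assert (HR := RInt_dominated_inv_sqr P f K Hup Hpos Hex Hb).
  destruct (filter_ex P HP) as [s0 Hs0].
  assert (HK : 0 <= K).
  { assert (H := Hb s0 Hs0). assert (H1 := Rabs_pos (f s0)). specialize (Hpos s0 Hs0).
    assert (0 < (1 + s0) ^ 2) by nra.
    replace K with (K / (1 + s0) ^ 2 * (1 + s0) ^ 2) by (field; lra). nra. }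
  assert (Hc : exists l, filterlim (fun ab => RInt f (fst ab) (snd ab))
                 (filter_prod Fa (Rbar_locally p_infty)) (locally l)).
  { apply (filterlim_locally_cauchy (U := R_CompleteSpace)). intros eps.
    (* Half of eps for each end: lower ends below eta move K/(1+s) by at most K eta, upper ends
       above T leave K/(1+t) < eps/2. Using K + 1 covers K = 0. *)
    set (eta := eps / (2 * (K + 1))).
    assert (Heta : 0 < eta) by (apply Rdiv_lt_0_compat; [apply eps | lra]).
    set (T := Rmax s0 (2 * (K + 1) / eps)).
    exists (fun ab => (P (fst ab) /\ fst ab < eta) /\ T < snd ab). split.
    - apply Filter_prod with (fun s => P s /\ s < eta) (fun t => T < t); [| |auto].
      + apply filter_and; [auto | apply (Hsm (mkposreal _ Heta))].
      + now exists T.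
    - assert (HT : forall t, T < t -> P t /\ 0 <= K / (1 + t) < eps / 2).
      { intros t Ht.
        assert (s0 < t) by (eapply Rle_lt_trans; [apply Rmax_l | apply Ht]).
        assert (2 * (K + 1) / eps < t) by (eapply Rle_lt_trans; [apply Rmax_r | apply Ht]).
        assert (Hp : P t) by (apply Hup with s0; auto; lra).
        specialize (Hpos t Hp). destruct eps as [eps He]; simpl in *.
        split; auto. split; [apply Rmult_le_pos; [lra | left; apply Rinv_0_lt_compat; lra]|].
        apply Rlt_div_l; [lra|].
        assert (2 * (K + 1) < t * eps) by (apply Rlt_div_l in H0; lra). nra. }
      intros [u1 u2] [v1 v2] [[Pu u1s] u2l] [[Pv v1s] v2l]; simpl in *.
      destruct (HT _ u2l) as [Pu2 Bu]. destruct (HT _ v2l) as [Pv2 Bv].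
      assert (E1 : RInt f v1 v2 - RInt f u1 u2 = RInt f v1 u1 + RInt f u2 v2).
      { rewrite <- (RInt_Chasles f v1 u1 v2), <- (RInt_Chasles f u1 u2 v2) by auto.
        unfold plus; simpl; ring. }
      change (Rabs (RInt f v1 v2 - RInt f u1 u2) < eps). rewrite E1.
      assert (B1 := HR v1 u1 Pv Pu). assert (B2 := HR u2 v2 Pu2 Pv2).
      assert (B3 : Rabs (K / (1 + u2) - K / (1 + v2)) < eps / 2) by (apply Rabs_def1; lra).
      assert (B4 : Rabs (K / (1 + v1) - K / (1 + u1)) <= eps / 2).
      { assert (HK1 : eta * (K + 1) = eps / 2) by (unfold eta; field; lra).
        assert (G : forall s, P s -> s < eta -> K - eps / 2 <= K / (1 + s) <= K).
        { intros s Ps hs. specialize (Hpos s Ps).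
          replace (K / (1 + s)) with (K - K * s / (1 + s)) by (field; lra).
          assert (0 <= K * s / (1 + s) <= K * s); [|nra].
          split; [apply Rmult_le_pos; [nra | left; apply Rinv_0_lt_compat; lra]|].
          apply Rle_div_l; [lra|]. nra. }
        assert (G1 := G _ Pv v1s). assert (G2 := G _ Pu u1s).
        apply Rabs_le; lra. }
      assert (Q := Rabs_triang (RInt f v1 u1) (RInt f u2 v2)). lra. }
  destruct Hc as [l Hl]. exists l.
  intros Q HQ. specialize (Hl Q HQ). unfold filtermap in Hl.
  assert (Hl' : filter_prod Fa (Rbar_locally p_infty) (fun ab => P (fst ab) /\ P (snd ab))).
  { apply Filter_prod with P P; auto.
    exists s0. intros t Ht. apply Hup with s0; auto; lra. }
  generalize (filter_and _ _ Hl Hl'). unfold filtermapi. apply filter_imp.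
  intros [u v] [H1 [H2 H3]]; simpl in *. exists (RInt f u v). split; auto.
  apply (RInt_correct (V := R_CompleteNormedModule)). auto.
Qed.

Lemma is_RInt_gen_primitive (Fa : (R -> Prop) -> Prop) (PF : ProperFilter Fa)
    (P : R -> Prop) (F f : R -> R) (la lb : R) :
  Fa P -> (forall s t, P s -> s <= t -> P t) ->
  (forall t, P t -> is_derive F t (f t)) -> (forall t, P t -> continuous f t) ->
  filterlim F Fa (locally la) -> filterlim F (Rbar_locally p_infty) (locally lb) ->
  is_RInt_gen f Fa (Rbar_locally p_infty) (lb - la).
Proof.
  intros HP Hup Hd Hc Ha Hb. destruct (filter_ex P HP) as [s0 Hs0].
  assert (Hl : filterlim (fun ab => F (snd ab) - F (fst ab))
    (filter_prod Fa (Rbar_locally p_infty)) (locally (lb - la))).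
  { apply (filterlim_comp_2 (G := locally lb) (H := locally (- la))
      (fun ab : R * R => F (snd ab)) (fun ab => - F (fst ab)) Rplus).
    - eapply filterlim_comp; [apply filterlim_snd | apply Hb].
    - eapply filterlim_comp; [eapply filterlim_comp; [apply filterlim_fst | apply Ha]|].
      apply (filterlim_opp (V := R_NormedModule)).
    - apply (filterlim_plus (V := R_NormedModule)). }
  assert (Hl' : filter_prod Fa (Rbar_locally p_infty) (fun ab => P (fst ab) /\ P (snd ab))).
  { apply Filter_prod with P P; auto.
    exists s0. intros t Ht. apply Hup with s0; auto; lra. }
  intros Q HQ. specialize (Hl Q HQ). unfold filtermap in Hl.
  generalize (filter_and _ _ Hl Hl'). unfold filtermapi. apply filter_imp.
  intros [u v] [H1 [H2 H3]]; simpl in *. exists (F v - F u). split; auto.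
  apply (is_RInt_derive (V := R_CompleteNormedModule) F f u v);
    intros t [Ht _]; [apply Hd | apply Hc];
    (revert Ht; apply Rmin_case; intros; [apply Hup with u | apply Hup with v]; auto).
Qed.

(** For an integer m > s, t^s <= (1+t)^m; the exponential also beats two further powers of 1+t, by
    [pow_le_fact_exp] at 1+t. The factor [exp 1] comes from that shift. *)
Lemma Gamma_integrand_dominated (s : R) : 0 <= s ->
  exists K, 0 < K /\ forall t, 0 < t -> Rabs (Rpower t s * exp (- t)) <= K / (1 + t) ^ 2.
Proof.
  intros Hs. destruct (INR_unbounded s) as [m Hm].
  exists (INR (fact (m + 2)) * exp 1). split.
  { apply Rmult_lt_0_compat; [apply INR_fact_lt_0 | apply exp_pos]. }
  intros t Ht.
  assert (Hp : 0 < Rpower t s) by apply exp_pos. assert (He := exp_pos (- t)).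
  rewrite Rabs_pos_eq by nra.
  apply -> Rle_div_r; [|apply pow_lt; lra].
  assert (H1 : Rpower t s <= (1 + t) ^ m).
  { rewrite <- Rpower_pow by lra.
    apply Rle_trans with (Rpower (1 + t) s); [apply Rle_Rpower_l; lra | apply Rle_Rpower; lra]. }
  assert (H2 := pow_le_fact_exp (m + 2) (1 + t)). rewrite exp_plus, pow_add in H2.
  assert (H3 : exp (- t) * exp t = 1) by (rewrite <- exp_plus, <- exp_0; f_equal; ring).
  assert (0 < (1 + t) ^ 2) by (apply pow_lt; lra).
  apply Rle_trans with (exp (- t) * ((1 + t) ^ m * (1 + t) ^ 2)).
  - replace (Rpower t s * exp (- t) * (1 + t) ^ 2) with (exp (- t) * (Rpower t s * (1 + t) ^ 2))
      by ring.
    apply Rmult_le_compat_l; [lra|]. apply Rmult_le_compat_r; lra.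
  - replace (INR (fact (m + 2)) * exp 1)
      with (exp (- t) * (INR (fact (m + 2)) * (exp 1 * exp t)))
      by (transitivity (INR (fact (m + 2)) * exp 1 * (exp (-t) * exp t)); [ring | rewrite H3;
          ring]).
    apply Rmult_le_compat_l; lra.
Qed.

Lemma Gamma_integrand_continuous (s t : R) :
  0 < t -> continuous (fun t => Rpower t s * exp (- t)) t.
Proof.
  intros Ht. apply (ex_derive_continuous (fun t => Rpower t s * exp (- t))).
  unfold Rpower. auto_derive. lra.
Qed.

(** For s >= 1 the integrand is bounded near 0. This range suffices, as n/g >= 1 for all large n. *)
Lemma is_RInt_gen_Gamma (s : R) : 1 <= s ->
  is_RInt_gen (fun t => Rpower t (s - 1) * exp (- t)) (at_right 0) (Rbar_locally p_infty) (Gamma s).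
Proof.
  intros Hs. unfold Gamma. apply (RInt_gen_correct (V := R_CompleteNormedModule)).
  destruct (Gamma_integrand_dominated (s - 1)) as [K [_ HK]]; [lra|].
  apply ex_RInt_gen_dominated with (fun t => 0 < t) K; auto.
  - apply at_right_proper_filter.
  - exists (mkposreal 1 Rlt_0_1). auto.
  - intros eps. exists eps. intros y Hy Hy0. unfold ball in Hy; simpl in Hy.
    unfold AbsRing_ball, abs, minus, plus, opp in Hy; simpl in Hy.
    rewrite Rabs_pos_eq in Hy; lra.
  - intros; lra.
  - intros; lra.
  - intros u v Hu Hv. apply (ex_RInt_continuous (V := R_CompleteNormedModule)).
    intros z [Hz _]. apply Gamma_integrand_continuous. revert Hz; apply Rmin_case; lra.
Qed.

Lemma filterlim_0_dominated_inv (F : R -> R) (K : R) :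
  (forall t, 0 < t -> Rabs (F t) <= K / (1 + t)) -> filterlim F (Rbar_locally p_infty) (locally 0).
Proof.
  intros HF. apply filterlim_locally. intros eps.
  exists (Rmax 0 (K / eps)). intros t Ht.
  assert (0 < t) by (eapply Rle_lt_trans; [apply Rmax_l | eauto]).
  assert (H1 : K / eps < t) by (eapply Rle_lt_trans; [apply Rmax_r | eauto]).
  destruct eps as [eps He]; simpl in *.
  change (Rabs (F t - 0) < eps). rewrite Rminus_0_r.
  eapply Rle_lt_trans; [apply HF; auto|].
  apply Rlt_div_l; [lra|]. apply Rlt_div_l in H1; [nra|lra].
Qed.

Lemma Gamma_1 : Gamma 1 = 1.
Proof.
  unfold Gamma at 1.
  apply (is_RInt_gen_unique (V := R_CompleteNormedModule)).
  cut (is_RInt_gen (fun t => Rpower t (1 - 1) * exp (- t)) (at_right 0) (Rbar_locally p_infty) (0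
      - (-1))).
  { now replace (0 - (-1)) with 1 by ring. }
  apply is_RInt_gen_primitive with (fun t => 0 < t) (fun t => - exp (- t)).
  - apply at_right_proper_filter.
  - exists (mkposreal 1 Rlt_0_1). auto.
  - intros; lra.
  - intros t Ht. replace (1 - 1) with 0 by ring. rewrite Rpower_O by auto.
    auto_derive; [auto | ring].
  - intros t Ht. now apply Gamma_integrand_continuous.
  - apply (filterlim_filter_le_1 (F := locally 0)); [apply filter_le_within|].
    replace (-1) with (- exp (- 0)) by (rewrite Ropp_0, exp_0; ring).
    apply (ex_derive_continuous (fun t => - exp (- t))). auto_derive; auto.
  - destruct (Gamma_integrand_dominated 0) as [K [HK0 HK]]; [lra|].
    apply filterlim_0_dominated_inv with K. intros t Ht.
    specialize (HK t Ht). rewrite Rpower_O, Rmult_1_l in HK by auto.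
    rewrite Rabs_Ropp. eapply Rle_trans; [apply HK|].
    apply Rmult_le_compat_l; [lra|]. apply Rinv_le_contravar; simpl; nra.
Qed.

(** Integration by parts: t^s e^(-t) vanishes at both ends, so the integral of its derivative is
    0. *)
Lemma Gamma_succ (s : R) : 1 <= s -> Gamma (s + 1) = s * Gamma s.
Proof.
  intros Hs.
  unfold Gamma at 1.
  apply (is_RInt_gen_unique (V := R_CompleteNormedModule)).
  assert (PF := at_right_proper_filter 0).
  assert (H1 : is_RInt_gen (fun t => Rpower t s * exp (- t) - s * (Rpower t (s - 1) * exp (- t)))
     (at_right 0) (Rbar_locally p_infty) (0 - 0)).
  { apply is_RInt_gen_primitive with (fun t => 0 < t) (fun t => - (Rpower t s * exp (- t))); auto.
    - exists (mkposreal 1 Rlt_0_1). auto.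
    - intros; lra.
    - intros t Ht. unfold Rminus at 2. rewrite Rpower_plus, Rpower_Ropp, Rpower_1 by auto.
      unfold Rpower. auto_derive; [auto | field; lra].
    - intros t Ht. apply (continuous_minus (V := R_NormedModule)).
      + now apply Gamma_integrand_continuous.
      + apply (continuous_scal_r (V := R_NormedModule)).
        now apply Gamma_integrand_continuous.
    - apply filterlim_locally. intros eps.
      assert (He : 0 < Rmin 1 eps) by (apply Rmin_case; [lra | apply eps]).
      exists (mkposreal _ He). intros t Ht Ht0.
      change (Rabs (t - 0) < Rmin 1 eps) in Ht. rewrite Rminus_0_r, Rabs_pos_eq in Ht by lra.
      assert (Ht1 := Rmin_l 1 eps). assert (Ht2 := Rmin_r 1 eps).
      change (Rabs (- (Rpower t s * exp (- t)) - 0) < eps).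
      rewrite Rminus_0_r, Rabs_Ropp.
      assert (Hp : 0 < Rpower t s) by apply exp_pos. assert (He1 := exp_pos (- t)).
      rewrite Rabs_pos_eq by nra.
      assert (He2 : exp (- t) <= 1) by (rewrite <- exp_0; left; apply exp_increasing; lra).
      assert (Rpower t s <= t).
      (* For 0 < t < 1 and s >= 1, t^s <= t; this makes the boundary term at 0 vanish. *)
      { rewrite <- (Rpower_1 t) at 2 by auto. unfold Rpower.
        assert (ln t < 0) by (rewrite <- ln_1; apply ln_increasing; lra).
        destruct (Req_dec s 1) as [->|]; [lra|]. left. apply exp_increasing. nra. }
      nra.
    - destruct (Gamma_integrand_dominated s) as [K [HK0 HK]]; [lra|].
      apply filterlim_0_dominated_inv with K. intros t Ht.
      rewrite Rabs_Ropp. eapply Rle_trans; [apply HK; auto|].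
      apply Rmult_le_compat_l; [lra|]. apply Rinv_le_contravar; simpl; nra. }
  assert (H2 := is_RInt_gen_plus _ _ _ _ H1 (is_RInt_gen_scal _ s _ (is_RInt_gen_Gamma s Hs))).
  unfold plus, scal in H2; simpl in H2. unfold mult in H2; simpl in H2.
  replace (0 - 0 + s * Gamma s) with (s * Gamma s) in H2 by ring.
  eapply is_RInt_gen_ext; [|apply H2].
  apply filter_forall. intros ab t _. replace (s + 1 - 1) with s by ring. simpl. ring.
Qed.

(** On [1, 2] the integrand is at least e^(-2), so every integral over a larger interval is too, and
    the limit cannot fall below. *)
Lemma Gamma_pos (s : R) : 1 <= s -> 0 < Gamma s.
Proof.
  intros Hs. assert (HG := is_RInt_gen_Gamma s Hs).
  set (f := fun t => Rpower t (s - 1) * exp (- t)) in *.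
  assert (Hf : forall t, 0 <= f t).
  { intros t. left. apply Rmult_lt_0_compat; apply exp_pos. }
  assert (Hex : forall u v, 0 < u -> 0 < v -> ex_RInt f u v).
  { intros u v Hu Hv. apply (ex_RInt_continuous (V := R_CompleteNormedModule)).
    intros z [Hz _]. apply Gamma_integrand_continuous. revert Hz; apply Rmin_case; lra. }
  apply Rlt_le_trans with (exp (- 2)); [apply exp_pos|].
  apply Rnot_lt_le. intros Hlt.
  assert (HQ : locally (Gamma s) (fun y => y < exp (- 2))) by (apply (open_lt (exp (-2))); auto).
  specialize (HG _ HQ). unfold filtermapi in HG.
  assert (HP : filter_prod (at_right 0) (Rbar_locally p_infty) (fun ab => 0 < fst ab < 1 /\ 2 <
      snd ab)).
  { apply Filter_prod with (fun u => 0 < u < 1) (fun v => 2 < v); auto.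
    - exists (mkposreal 1 Rlt_0_1). intros y Hy Hy0. change (Rabs (y - 0) < 1) in Hy.
      rewrite Rminus_0_r, Rabs_pos_eq in Hy; lra.
    - now exists 2. }
  assert (PF := at_right_proper_filter 0).
  destruct (filter_ex _ (filter_and _ _ HG HP)) as [[u v] [[y [Hy1 Hy2]] [H1 H2]]]; simpl in *.
  apply (is_RInt_unique (V := R_CompleteNormedModule)) in Hy1.
  rewrite <- (RInt_Chasles f u 1 v), <- (RInt_Chasles f 1 2 v) in Hy1 by (apply Hex; lra).
  unfold plus in Hy1; simpl in Hy1.
  assert (0 <= RInt f u 1) by (apply RInt_ge_0; auto; [lra | apply Hex; lra]).
  assert (0 <= RInt f 2 v) by (apply RInt_ge_0; auto; [lra | apply Hex; lra]).
  assert (exp (- 2) <= RInt f 1 2); [|lra].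
  replace (exp (- 2)) with (RInt (fun _ => exp (- 2)) 1 2)
    by (rewrite RInt_const; unfold scal; simpl; unfold mult; simpl; ring).
  apply RInt_le; [lra | apply ex_RInt_const | apply Hex; lra |].
  intros t Ht. unfold f.
  assert (exp (-2) < exp (-t)) by (apply exp_increasing; lra).
  assert (1 <= Rpower t (s - 1)).
  { rewrite <- (Rpower_O t) at 1 by lra. apply Rle_Rpower; lra. }
  apply Rle_trans with (1 * exp (- t)); [lra|].
  apply Rmult_le_compat_r; [left; apply exp_pos | lra].
Qed.

(** * Means under the negative binomial distribution *)

(** The sequences whose negative binomial means converge. [Series] returns a default value on
    divergent series, so every splitting of a mean needs this hypothesis; the class is closed under
    sums, products and multiplication by k. *)
Definition poly_growth (A : nat -> R) : Prop :=
  exists (M : nat) (C : R), forall k, Rabs (A k) <= C * (1 + INR k) ^ M.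

Lemma poly_growth_le (A B : nat -> R) :
  (forall k, Rabs (A k) <= Rabs (B k)) -> poly_growth B -> poly_growth A.
Proof. intros H [M [C HB]]. exists M, C. intros k. eapply Rle_trans; auto. Qed.

Lemma poly_growth_const (a : R) : poly_growth (fun _ => a).
Proof. exists 0%nat, (Rabs a). intros k. simpl. lra. Qed.

Lemma poly_growth_INR : poly_growth INR.
Proof.
  exists 1%nat, 1. intros k. assert (H := pos_INR k). rewrite Rabs_pos_eq; simpl; lra.
Qed.

Lemma poly_growth_plus (A B : nat -> R) :
  poly_growth A -> poly_growth B -> poly_growth (fun k => A k + B k).
Proof.
  intros [M [C HA]] [M' [C' HB]]. exists (Nat.max M M'), (Rabs C + Rabs C'). intros k.
  assert (Hk := pos_INR k).
  assert (L : forall D m, (m <= Nat.max M M')%nat ->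
            D * (1 + INR k) ^ m <= Rabs D * (1 + INR k) ^ Nat.max M M').
  { intros D m Hm. apply Rle_trans with (Rabs D * (1 + INR k) ^ m).
    - apply Rmult_le_compat_r; [apply pow_le; lra | apply Rle_abs].
    - apply Rmult_le_compat_l; [apply Rabs_pos | apply Rle_pow; [lra | auto]]. }
  assert (L1 := L C M (Nat.le_max_l _ _)). assert (L2 := L C' M' (Nat.le_max_r _ _)).
  assert (T := Rabs_triang (A k) (B k)). specialize (HA k). specialize (HB k). lra.
Qed.

Lemma poly_growth_mult (A B : nat -> R) :
  poly_growth A -> poly_growth B -> poly_growth (fun k => A k * B k).
Proof.
  intros [M [C HA]] [M' [C' HB]]. exists (M + M')%nat, (C * C'). intros k.
  rewrite Rabs_mult, pow_add.
  replace (C * C' * ((1 + INR k) ^ M * (1 + INR k) ^ M'))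
    with ((C * (1 + INR k) ^ M) * (C' * (1 + INR k) ^ M')) by ring.
  apply Rmult_le_compat; auto; apply Rabs_pos.
Qed.

Lemma poly_growth_pow (A : nat -> R) (m : nat) :
  poly_growth A -> poly_growth (fun k => A k ^ m).
Proof.
  intros HA. induction m as [|m IH]; simpl; [apply poly_growth_const | now apply poly_growth_mult].
Qed.

Lemma poly_growth_Rabs (A : nat -> R) : poly_growth A -> poly_growth (fun k => Rabs (A k)).
Proof. apply poly_growth_le. intros k. rewrite Rabs_Rabsolu. lra. Qed.

(** * Negative binomial coefficients and the binomial series *)

Fixpoint poch (c : R) (k : nat) : R :=
  match k with O => 1 | S k' => poch c k' * (c + INR k') end.

(** The coefficient of z^k in (1 - z)^(-c), for real c. *)
Definition nb_coef (c : R) (k : nat) : R := poch c k / INR (fact k).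

Lemma nb_coef_0 (c : R) : nb_coef c 0 = 1.
Proof. unfold nb_coef; simpl. field. Qed.

Lemma nb_coef_S (c : R) (k : nat) : nb_coef c (S k) = nb_coef c k * ((c + INR k) / (INR k + 1)).
Proof.
  unfold nb_coef. rewrite fact_simpl, mult_INR, S_INR. simpl poch.
  assert (H := INR_fact_lt_0 k). assert (H1 := pos_INR k). field. lra.
Qed.

Lemma nb_coef_pos (c : R) (k : nat) : 0 < c -> 0 < nb_coef c k.
Proof.
  intros Hc. induction k as [|k IH]; [rewrite nb_coef_0; lra|].
  rewrite nb_coef_S. assert (H1 := pos_INR k).
  apply Rmult_lt_0_compat; [auto | apply Rdiv_lt_0_compat; lra].
Qed.

Lemma is_lim_seq_inv_INR_succ (a : R) : is_lim_seq (fun k => a / (INR k + 1)) 0.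
Proof.
  replace (Finite 0) with (Rbar_mult a 0) by (simpl; f_equal; ring).
  apply (is_lim_seq_scal_l (fun k => / (INR k + 1))).
  apply (is_lim_seq_ext (fun k => / INR (S k))).
  { intros k. now rewrite S_INR. }
  replace (Finite 0) with (Rbar_inv p_infty) by reflexivity.
  apply is_lim_seq_inv; [|easy].
  apply (is_lim_seq_incr_1 INR), is_lim_seq_INR.
Qed.

Lemma CV_radius_nb_coef_pow (c : R) (M : nat) :
  0 < c -> CV_radius (fun k => nb_coef c k * (1 + INR k) ^ M) = Finite 1.
Proof.
  intros Hc. replace (Finite 1) with (Finite (/ 1)) by (f_equal; apply Rinv_1).
  apply (CV_radius_finite_DAlembert _ 1); [| lra |].
  - intros k. assert (H := nb_coef_pos c k Hc). assert (0 < (1 + INR k) ^ M).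
    { apply pow_lt. assert (H1 := pos_INR k). lra. }
    apply Rmult_integral_contrapositive_currified; apply Rgt_not_eq; lra.
  - apply (is_lim_seq_ext (fun k => (1 + (c - 1) / (INR k + 1)) * (1 + 1 / (INR k + 1)) ^ M)).
    + intros k. assert (H := nb_coef_pos c k Hc). assert (H1 := pos_INR k).
      assert (Hp : 0 < (1 + INR k) ^ M) by (apply pow_lt; lra).
      rewrite nb_coef_S, S_INR.
      replace (1 + 1 / (INR k + 1)) with ((1 + (INR k + 1)) * / (1 + INR k)) by (field; lra).
      rewrite Rpow_mult_distr, pow_inv.
      assert (0 < (1 + (INR k + 1)) ^ M) by (apply pow_lt; lra).
      rewrite Rabs_pos_eq.
      * field. lra.
      * apply Rmult_le_pos; [|left; apply Rinv_0_lt_compat; nra].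
        apply Rmult_le_pos; [|lra]. apply Rmult_le_pos; [lra|].
        apply Rmult_le_pos; [lra|]. left; apply Rinv_0_lt_compat; lra.
    + assert (L : forall a, is_lim_seq (fun k => 1 + a / (INR k + 1)) 1).
      { intros a. replace (Finite 1) with (Finite (1 + 0)) by (f_equal; ring).
        apply is_lim_seq_plus'; [apply is_lim_seq_const | apply is_lim_seq_inv_INR_succ]. }
      replace (Finite 1) with (Finite (1 * 1)) by (f_equal; ring).
      apply is_lim_seq_mult'; [apply L|].
      induction M as [|M IH]; simpl; [apply is_lim_seq_const|].
      replace (Finite 1) with (Finite (1 * 1)) by (f_equal; ring).
      apply is_lim_seq_mult'; [apply L | apply IH].
Qed.

(** At r strictly between |s| and 1 the majorant series converges by [CV_radius_nb_coef_pow]; its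
    terms are bounded there, hence so are those for A, and the radius is at least r. *)
Lemma CV_radius_nb_coef (c : R) (A : nat -> R) (s : R) :
  0 < c -> poly_growth A -> Rabs s < 1 -> Rbar_lt (Rabs s) (CV_radius (fun k => nb_coef c k * A k)).
Proof.
  intros Hc [M [C HA]] Hs.
  set (r := (Rabs s + 1) / 2). assert (Hs0 := Rabs_pos s).
  apply Rbar_lt_le_trans with r; [simpl; unfold r; lra|].
  destruct (CV_radius_bounded (fun k => nb_coef c k * A k)) as [Hub _].
  apply Hub.
  assert (Hin : Rbar_lt (Rabs r) (CV_radius (fun k => nb_coef c k * (1 + INR k) ^ M))).
  { rewrite CV_radius_nb_coef_pow by auto. simpl. rewrite Rabs_pos_eq; unfold r; lra. }
  assert (Hlim := ex_series_lim_0 _ (CV_radius_inside _ _ Hin)).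
  destruct (filterlim_bounded (K := R_AbsRing) (V := R_NormedModule) _
    (ex_intro (fun l => filterlim _ eventually (locally l)) 0 Hlim)) as [B HB].
  exists (Rabs C * B). intros k. specialize (HB k). specialize (HA k).
  change (Rabs (scal (pow_n r k) (nb_coef c k * (1 + INR k) ^ M)) <= B) in HB.
  rewrite pow_n_pow in HB. unfold scal in HB; simpl in HB. unfold mult in HB; simpl in HB.
  assert (Hw := nb_coef_pos c k Hc).
  assert (0 <= (1 + INR k) ^ M) by (apply pow_le; assert (H1 := pos_INR k); lra).
  assert (0 <= r ^ k) by (apply pow_le; unfold r; lra).
  rewrite !Rabs_mult, (Rabs_pos_eq (r ^ k)), (Rabs_pos_eq (nb_coef c k)) by lra.
  rewrite Rabs_pos_eq in HB by (apply Rmult_le_pos; [|apply Rmult_le_pos]; lra).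
  assert (C <= Rabs C) by apply Rle_abs.
  assert (0 <= nb_coef c k * r ^ k) by (apply Rmult_le_pos; lra).
  apply Rle_trans with (nb_coef c k * r ^ k * (C * (1 + INR k) ^ M)).
  - replace (nb_coef c k * Rabs (A k) * r ^ k) with (nb_coef c k * r ^ k * Rabs (A k)) by ring.
    apply Rmult_le_compat_l; auto.
  - apply Rle_trans with (Rabs C * (r ^ k * (nb_coef c k * (1 + INR k) ^ M))).
    + replace (nb_coef c k * r ^ k * (C * (1 + INR k) ^ M))
        with (C * (r ^ k * (nb_coef c k * (1 + INR k) ^ M))) by ring.
      apply Rmult_le_compat_r; auto. apply Rmult_le_pos; [|apply Rmult_le_pos]; lra.
    + apply Rmult_le_compat_l; [apply Rabs_pos | auto].
Qed.

Lemma PSeries_INR_mult (a : nat -> R) (s : R) :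
  PSeries (fun k => INR k * a k) s = s * PSeries (PS_derive a) s.
Proof.
  rewrite <- PSeries_incr_1. apply PSeries_ext. intros [|k]; simpl.
  - unfold zero; simpl. ring.
  - unfold PS_derive. reflexivity.
Qed.

(** The sum F solves (1 - s) F' = c F, so F(s) (1 - s)^c has zero derivative on (-1, 1) and equals
    its value 1 at s = 0. *)
Lemma binomial_series (c z : R) : 0 < c -> 0 <= z < 1 -> PSeries (nb_coef c) z = Rpower (1 - z)
    (- c).
Proof.
  intros Hc Hz.
  assert (Hr : forall s, Rabs s < 1 -> Rbar_lt (Rabs s) (CV_radius (nb_coef c))).
  { intros s Hs. rewrite (CV_radius_ext (nb_coef c) (fun k => nb_coef c k * 1)) by (intros; ring).
    apply CV_radius_nb_coef; auto. apply poly_growth_const. }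
  set (F := PSeries (nb_coef c)). set (F' := PSeries (PS_derive (nb_coef c))).
  assert (Hode : forall s, Rabs s < 1 -> (1 - s) * F' s = c * F s).
  { intros s Hs.
    assert (F' s = c * F s + s * F' s); [|lra].
    unfold F' at 2. rewrite <- PSeries_INR_mult. unfold F. rewrite <- PSeries_scal, <- PSeries_plus.
    - apply PSeries_ext. intros k. unfold PS_plus, PS_scal, PS_derive, plus, scal; simpl.
      unfold mult; simpl. change (match k with O => 1 | S _ => INR k + 1 end) with (INR (S k)).
      rewrite nb_coef_S, S_INR. assert (H1 := pos_INR k). field. lra.
    - apply (ex_pseries_scal (K := R_AbsRing) (V := R_NormedModule));
        [apply Rmult_comm | apply CV_radius_inside, Hr, Hs].
    - apply CV_radius_inside. rewrite (CV_radius_ext _ (fun k => nb_coef c k * INR k))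
        by (intros; ring).
      apply CV_radius_nb_coef; auto. apply poly_growth_INR. }
  assert (Hd : forall s, Rabs s < 1 -> is_derive (fun s => F s * Rpower (1 - s) c) s 0).
  { intros s Hs. assert (Hs' := Rabs_def2 _ _ Hs).
    replace 0 with (F' s * Rpower (1 - s) c + F s * (- (c / (1 - s) * Rpower (1 - s) c))).
    - apply (is_derive_mult F (fun s => Rpower (1 - s) c));
        [apply is_derive_PSeries, Hr, Hs | | apply Rmult_comm].
      unfold Rpower. auto_derive; [lra | unfold Rminus; field; lra].
    - replace (F' s) with (c * F s / (1 - s)) by (rewrite <- Hode by auto; field; lra). field.
      lra. }
  destruct (MVT_gen (fun s => F s * Rpower (1 - s) c) 0 z (fun _ => 0)) as [u [_ Hu]].
  - intros u. rewrite Rmin_left, Rmax_right by lra. intros Hu. apply Hd. apply Rabs_def1; lra.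
  - intros u. rewrite Rmin_left, Rmax_right by lra. intros Hu.
    apply continuity_pt_filterlim, (ex_derive_continuous (fun s => F s * Rpower (1 - s) c)).
    eexists. apply Hd. apply Rabs_def1; lra.
  - unfold F in Hu at 2. rewrite PSeries_0, nb_coef_0 in Hu.
    replace (Rpower (1 - 0) c) with 1 in Hu
      by (unfold Rpower; rewrite Rminus_0_r, ln_1, Rmult_0_r, exp_0; reflexivity).
    rewrite Rpower_Ropp. fold F. assert (0 < Rpower (1 - z) c) by apply exp_pos.
    apply Rmult_eq_reg_r with (Rpower (1 - z) c); [|lra]. rewrite Rinv_l; lra.
Qed.

(** * The distribution in k and its means as functions of y *)

Definition nb_prob (c g : R) (k : nat) (y : R) : R :=
  nb_coef c k * ((g * y) ^ k / Rpower (1 + g * y) (c + INR k)).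

Definition nb_mean (c g : R) (A : nat -> R) (y : R) : R := Series (fun k => nb_prob c g k y * A k).

(** The parameter z of the distribution: 1 - z = 1/(1 + g y), so the k-th probability is (1 - z)^c
    [nb_coef c k] z^k and a mean becomes a power series in z. *)
Definition odds (g y : R) : R := g * y / (1 + g * y).

Lemma odds_bounds (g y : R) : 0 < g -> 0 < y -> 0 < odds g y < 1.
Proof.
  intros Hg Hy. unfold odds. assert (0 < g * y) by nra.
  split; [apply Rdiv_lt_0_compat; lra|]. apply Rlt_div_l; lra.
Qed.

Lemma nb_prob_eq (c g : R) (k : nat) (y : R) : 0 < g -> 0 < y ->
  nb_prob c g k y = Rpower (1 + g * y) (- c) * (nb_coef c k * odds g y ^ k).
Proof.
  intros Hg Hy. assert (0 < g * y) by nra.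
  unfold nb_prob, odds. rewrite Rpower_plus, Rpower_Ropp, Rpower_pow by lra.
  unfold Rdiv; rewrite (Rpow_mult_distr (g * y)), pow_inv.
  assert (0 < (1 + g * y) ^ k) by (apply pow_lt; lra).
  assert (0 < Rpower (1 + g * y) c) by apply exp_pos. field. lra.
Qed.

Lemma nb_prob_pos (c g : R) (k : nat) (y : R) : 0 < c -> 0 < g -> 0 < y -> 0 < nb_prob c g k y.
Proof.
  intros Hc Hg Hy. rewrite nb_prob_eq by auto.
  apply Rmult_lt_0_compat; [apply exp_pos|]. apply Rmult_lt_0_compat; [now apply nb_coef_pos|].
  apply pow_lt. now apply odds_bounds.
Qed.

Section Expectation.
Variables c g : R.
Hypotheses (Hc : 0 < c) (Hg : 0 < g).

Lemma ex_series_nb_mean (A : nat -> R) (y : R) :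
  0 < y -> poly_growth A -> ex_series (fun k => nb_prob c g k y * A k).
Proof.
  intros Hy HA. assert (Ho := odds_bounds g y Hg Hy).
  assert (H := CV_radius_nb_coef c A (odds g y) Hc HA). rewrite Rabs_pos_eq in H by lra.
  assert (H1 := CV_radius_inside (fun k => nb_coef c k * A k) (odds g y)).
  rewrite Rabs_pos_eq in H1 by lra.
  destruct (H1 (H (proj2 Ho))) as [l Hl]. apply is_pseries_R in Hl.
  exists (Rpower (1 + g * y) (- c) * l).
  apply is_series_ext with (fun k => Rpower (1 + g * y) (- c) * (nb_coef c k * A k * odds g y ^ k)).
  - intros k. rewrite nb_prob_eq by auto. simpl. ring.
  - now apply (is_series_scal_l (K := R_AbsRing) (V := R_NormedModule) (Rpower (1 + g * y) (- c))
      (fun k => nb_coef c k * A k * odds g y ^ k)).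
Qed.

Lemma nb_mean_PSeries (A : nat -> R) (y : R) : 0 < y ->
  nb_mean c g A y = Rpower (1 + g * y) (- c) * PSeries (fun k => nb_coef c k * A k) (odds g y).
Proof.
  intros Hy. unfold nb_mean, PSeries. rewrite <- Series_scal_l. apply Series_ext.
  intros k. rewrite nb_prob_eq by auto. ring.
Qed.

Lemma nb_mean_ext (A B : nat -> R) (y : R) : (forall k,
    A k = B k) -> nb_mean c g A y = nb_mean c g B y.
Proof. intros H. apply Series_ext. intros k. now rewrite H. Qed.

Lemma nb_mean_plus (A B : nat -> R) (y : R) : 0 < y -> poly_growth A -> poly_growth B ->
  nb_mean c g (fun k => A k + B k) y = nb_mean c g A y + nb_mean c g B y.
Proof.
  intros Hy HA HB. unfold nb_mean. rewrite <- Series_plus by (now apply ex_series_nb_mean).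
  apply Series_ext. intros k. ring.
Qed.

Lemma nb_mean_scal (a : R) (A : nat -> R) (y : R) : nb_mean c g (fun k => a * A k) y = a *
    nb_mean c g A y.
Proof.
  unfold nb_mean. rewrite <- Series_scal_l. apply Series_ext. intros k. ring.
Qed.

Lemma nb_mean_Rabs_le (A B : nat -> R) (y : R) : 0 < y -> poly_growth B ->
  (forall k, Rabs (A k) <= B k) -> Rabs (nb_mean c g A y) <= nb_mean c g B y.
Proof.
  intros Hy HB HAB. unfold nb_mean.
  assert (Hp : forall k, 0 <= nb_prob c g k y) by (intros k; left; now apply nb_prob_pos).
  assert (Hs := ex_series_nb_mean B y Hy HB).
  assert (Hk : forall k, 0 <= Rabs (nb_prob c g k y * A k) <= nb_prob c g k y * B k).
  { intros k. split; [apply Rabs_pos|]. rewrite Rabs_mult, (Rabs_pos_eq (nb_prob c g k y)) by auto.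
    now apply Rmult_le_compat_l. }
  eapply Rle_trans; [apply Series_Rabs | apply Series_le; auto].
  apply (ex_series_le (K := R_AbsRing) (V := R_CompleteNormedModule)) with (fun k => nb_prob c g
      k y * B k); auto.
  intros k. unfold norm; simpl. unfold abs; simpl. rewrite Rabs_Rabsolu. apply Hk.
Qed.

(** Termwise differentiation of the power series in [odds]: the derivative of [odds] is g/(1 + g
    y)^2, and s P'(s) has the coefficients k a_k, which produces the mean of k A. *)
Lemma is_derive_nb_mean (A : nat -> R) (y : R) : 0 < y -> poly_growth A ->
  is_derive (nb_mean c g A) y
    ((nb_mean c g (fun k => INR k * A k) y - g * c * y * nb_mean c g A y) / (y * (1 + g * y))).
Proof.
  intros Hy HA. assert (Hgy : 0 < g * y) by nra.
  set (a := fun k => nb_coef c k * A k).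
  apply is_derive_ext_loc with (fun y => Rpower (1 + g * y) (- c) * PSeries a (odds g y)).
  { exists (mkposreal y Hy). intros z Hz. change (Rabs (z - y) < y) in Hz.
    apply Rabs_def2 in Hz. symmetry. apply nb_mean_PSeries. lra. }
  rewrite !nb_mean_PSeries by auto.
  rewrite (PSeries_ext (fun k => nb_coef c k * (INR k * A k)) (fun k => INR k * a k))
    by (intros k; unfold a; ring).
  rewrite PSeries_INR_mult. fold a.
  set (p := PSeries a). set (dp := PSeries (PS_derive a)).
  assert (Ho := odds_bounds g y Hg Hy).
  assert (Hdp : is_derive p (odds g y) (dp (odds g y))).
  { apply is_derive_PSeries, CV_radius_nb_coef; auto. rewrite Rabs_pos_eq; lra. }
  assert (Hd1 : is_derive (fun y => Rpower (1 + g * y) (- c)) y (- c * g / (1 + g * y) * Rpower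
      (1 + g * y) (- c))).
  { unfold Rpower. auto_derive; [lra | field; lra]. }
  assert (Hd2 : is_derive (odds g) y (g / (1 + g * y) ^ 2)).
  { unfold odds. auto_derive; [lra | field; lra]. }
  assert (Hd3 := is_derive_comp p (odds g) y _ _ Hdp Hd2).
  assert (Hd4 := is_derive_mult _ _ _ _ _ Hd1 Hd3 Rmult_comm).
  revert Hd4. unfold plus, mult, scal; simpl. unfold mult; simpl. intros Hd4.
  match type of Hd4 with is_derive _ _ ?L => match goal with |- is_derive _ _ ?R =>
    replace R with L; [exact Hd4|] end end.
  generalize (p (odds g y)) (dp (odds g y)). intros u v. unfold odds. field. lra.
Qed.

(** The probability generating function. The condition on z says [odds g y * z < 1], which puts the
    binomial series at [odds g y * z] inside its disc of convergence. *)
Lemma is_series_exp_moment (y z : R) : 0 < y -> 0 <= z -> g * y * (z - 1) < 1 ->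
  is_series (fun k => nb_prob c g k y * z ^ k) (Rpower (1 - g * y * (z - 1)) (- c)).
Proof.
  intros Hy Hz Hlt. assert (Hgy : 0 < g * y) by nra.
  assert (Ho := odds_bounds g y Hg Hy).
  assert (Hoz : 0 <= odds g y * z < 1).
  { split; [nra|]. unfold odds. replace (g * y / (1 + g * y) * z) with (g * y * z / (1 + g * y))
      by (field; lra).
    apply Rlt_div_l; nra. }
  assert (Hex : ex_pseries (nb_coef c) (odds g y * z)).
  { apply CV_radius_inside. rewrite (CV_radius_ext (nb_coef c) (fun k => nb_coef c k * 1))
      by (intros; ring).
    apply CV_radius_nb_coef; auto; [apply poly_growth_const | rewrite Rabs_pos_eq; lra]. }
  assert (Hs := PSeries_correct _ _ Hex). rewrite binomial_series in Hs by auto.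
  apply is_pseries_R in Hs.
  replace (Rpower (1 - g * y * (z - 1)) (- c))
    with (Rpower (1 + g * y) (- c) * Rpower (1 - odds g y * z) (- c)).
  - apply is_series_ext with (fun k => Rpower (1 + g * y) (- c) * (nb_coef c k * (odds g y * z) ^
      k)).
    + intros k. rewrite nb_prob_eq, Rpow_mult_distr by auto. simpl. ring.
    + now apply (is_series_scal_l (K := R_AbsRing) (V := R_NormedModule) (Rpower (1 + g * y) (- c))
        (fun k => nb_coef c k * (odds g y * z) ^ k)).
  - rewrite Rpower_mult_distr by lra.
    f_equal. unfold odds. field. lra.
Qed.

Lemma nb_mean_one (y : R) : 0 < y -> nb_mean c g (fun _ => 1) y = 1.
Proof.
  intros Hy. assert (H := is_series_exp_moment y 1 Hy). unfold nb_mean.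
  rewrite (Series_ext _ (fun k => nb_prob c g k y * 1 ^ k)) by (intros k; now rewrite pow1).
  rewrite (is_series_unique _ _ (H ltac:(lra) ltac:(lra))).
  replace (1 - g * y * (1 - 1)) with 1 by ring. unfold Rpower. rewrite ln_1, Rmult_0_r. apply exp_0.
Qed.

(** * Derivatives of arbitrary order *)

(* The r-th derivative of [nb_mean c g A] at y: differentiating the first-order equation
   y (1 + g y) E' = E[k A] - g c y E  r times (Leibniz) gives this recurrence. *)
Fixpoint nb_mean_der (r : nat) (A : nat -> R) (y : R) : R :=
  match r with
  | O => nb_mean c g A y
  | S r' => (nb_mean_der r' (fun k => INR k * A k) y - (g * c * y + INR r' * (1 + 2 * g * y)) *
      nb_mean_der r' A y
             - INR r' * (g * c + g * (INR r' - 1)) * nb_mean_der (pred r') A y) / (y * (1 + g * y))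
  end.

(* The ratio of the r-th derivative of [nb_prob c g k] to [nb_prob c g k] itself, by the same
   recurrence. *)
Fixpoint nb_score (y : R) (r k : nat) : R :=
  match r with
  | O => 1
  | S r' => ((INR k - (g * c * y + INR r' * (1 + 2 * g * y))) * nb_score y r' k
             - INR r' * (g * c + g * (INR r' - 1)) * nb_score y (pred r') k) / (y * (1 + g * y))
  end.

Lemma poly_growth_INR_mult (A : nat -> R) : poly_growth A -> poly_growth (fun k => INR k * A k).
Proof. intros H. apply poly_growth_mult; [apply poly_growth_INR | auto]. Qed.

Lemma poly_growth_nb_score (y : R) (r : nat) : poly_growth (nb_score y r).
Proof.
  (* The recurrence reaches back two orders, so the induction carries r and [pred r] together. At
     order 0, where [pred 0 = 0] has no meaning, the coefficient [INR 0] removes the term. The same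
     device recurs below. *)
  enough (H : poly_growth (nb_score y r) /\ poly_growth (nb_score y (pred r))) by apply H.
  induction r as [|r [IH1 IH2]].
  - split; exact (poly_growth_const 1).
  - split; [|auto]. cbn [nb_score].
    apply (poly_growth_mult (fun k => _) (fun _ => / (y * (1 + g * y))));
        [|apply poly_growth_const].
    apply (poly_growth_plus (fun k => _) (fun k => - (INR r * (g * c + g * (INR r - 1)) *
        nb_score y (pred r) k))).
    + apply (poly_growth_mult (fun k => INR k - _)); auto.
      apply (poly_growth_plus INR (fun _ => _)); [apply poly_growth_INR | apply poly_growth_const].
    + apply (poly_growth_le _ (fun k => (INR r * (g * c + g * (INR r - 1))) * nb_score y (pred r)
        k)).
      * intros k. rewrite Rabs_Ropp. lra.
      * apply (poly_growth_mult (fun _ => _)); [apply poly_growth_const | auto].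
Qed.

(** The recurrence form is suited to exact computation, this one to estimates: the derivative is
    again a mean, so absolute values can be taken inside it, and linearity in A is inherited. *)
Lemma nb_mean_der_eq (r : nat) (A : nat -> R) (y : R) : 0 < y -> poly_growth A ->
  nb_mean_der r A y = nb_mean c g (fun k => nb_score y r k * A k) y.
Proof.
  intros Hy. revert A.
  enough (H : forall A, poly_growth A -> nb_mean_der r A y = nb_mean c g (fun k => nb_score y r k
      * A k) y /\
                nb_mean_der (pred r) A y = nb_mean c g (fun k => nb_score y (pred r) k * A k) y)
                    by apply H.
  induction r as [|r IH]; intros A HA.
  - simpl. split; apply nb_mean_ext; intros k; ring.
  - split; [|apply IH; auto]. cbn [nb_mean_der pred].
    rewrite (proj1 (IH A HA)), (proj2 (IH A HA)), (proj1 (IH _ (poly_growth_INR_mult A HA))).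
    assert (P1 : poly_growth (fun k => nb_score y r k * (INR k * A k)))
      by (apply poly_growth_mult; [apply poly_growth_nb_score | now apply poly_growth_INR_mult]).
    assert (P2 : forall a j, poly_growth (fun k => a * (nb_score y j k * A k))).
    { intros a j. apply (poly_growth_mult (fun _ => a)); [apply poly_growth_const|].
      apply poly_growth_mult; [apply poly_growth_nb_score | auto]. }
    set (u := g * c * y + INR r * (1 + 2 * g * y)). set (v := INR r * (g * c + g * (INR r - 1))).
    rewrite (nb_mean_ext (fun k => nb_score y (S r) k * A k) (fun k => / (y * (1 + g * y)) *
      (nb_score y r k * (INR k * A k) + (- u * (nb_score y r k * A k) + - v * (nb_score y (pred
          r) k * A k))))).
    + rewrite nb_mean_scal, !nb_mean_plus, !nb_mean_scal; auto.
      * unfold Rdiv. ring.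
      * apply poly_growth_plus; auto.
    + intros k. cbn [nb_score]. fold u v. unfold Rdiv. ring.
Qed.

Lemma is_derive_nb_mean_der (r : nat) (A : nat -> R) (y : R) : 0 < y -> poly_growth A ->
  is_derive (nb_mean_der r A) y (nb_mean_der (S r) A y).
Proof.
  intros Hy. assert (Hgy : 0 < g * y) by nra. revert A.
  (* The factor [INR r] in the second claim keeps it true at r = 0, where [pred 0] is not the
     preceding order. *)
  enough (H : forall A, poly_growth A -> is_derive (nb_mean_der r A) y (nb_mean_der (S r) A y) /\
       is_derive (fun y => INR r * nb_mean_der (pred r) A y) y (INR r * nb_mean_der r A y))
           by apply H.
  induction r as [|r IH]; intros A HA.
  - split.
    + assert (H := is_derive_nb_mean A y Hy HA). cbn [nb_mean_der pred]. cbn [INR].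
      match type of H with is_derive _ _ ?L => match goal with |- is_derive _ _ ?R =>
        replace R with L; [exact H|] end end.
      field. lra.
    + simpl INR. apply is_derive_ext with (fun _ => 0); [intros t; symmetry; apply Rmult_0_l|].
      replace (0 * nb_mean_der 0 A y) with 0 by ring. apply (is_derive_const (V := R_NormedModule)).
  - destruct (IH A HA) as [I1 I2].
    destruct (IH _ (poly_growth_INR_mult A HA)) as [I3 _].
    split.
    + set (kA := fun k => INR k * A k) in *.
      assert (E1 : nb_mean_der (S r) A y * (y * (1 + g * y)) =
         nb_mean_der r kA y - (g * c * y + INR r * (1 + 2 * g * y)) * nb_mean_der r A y
          - INR r * (g * c + g * (INR r - 1)) * nb_mean_der (pred r) A y) by (cbn [nb_mean_der];
              fold kA; field; lra).
      assert (D2 : is_derive (fun y => (g * c * y + INR r * (1 + 2 * g * y)) * nb_mean_der r A y) y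
         ((g * c + INR r * (2 * g)) * nb_mean_der r A y + (g * c * y + INR r * (1 + 2 * g * y)) *
             nb_mean_der (S r) A y)).
      { apply (is_derive_mult (fun y => g * c * y + INR r * (1 + 2 * g * y)) (nb_mean_der r A));
          [auto_derive; [auto | ring] | auto | apply Rmult_comm]. }
      assert (D3 : is_derive (fun y => (g * c + g * (INR r - 1)) * (INR r * nb_mean_der (pred r)
          A y)) y
         ((g * c + g * (INR r - 1)) * (INR r * nb_mean_der r A y))).
      { apply is_derive_scal. auto. }
      assert (D4 := is_derive_minus _ _ _ _ _ (is_derive_minus _ _ _ _ _ I3 D2) D3).
      assert (D5 : is_derive (fun y => / (y * (1 + g * y))) y (- (1 + 2 * g * y) / (y * (1 + g *
          y)) ^ 2)).
      { auto_derive; [nra | field; lra]. }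
      assert (D6 := is_derive_mult _ _ _ _ _ D4 D5 Rmult_comm).
      revert D6. unfold minus, plus, opp, mult; simpl. unfold mult; simpl. intros D6.
      apply (is_derive_ext _ (nb_mean_der (S r) A)) in D6;
        [|intros t; match goal with |- ?x = ?z => change (@eq R x z) end;
          cbn [nb_mean_der]; fold kA; unfold Rdiv; ring].
      match type of D6 with is_derive _ _ ?L => match goal with |- is_derive _ _ ?R =>
        replace R with L; [exact D6|] end end.
      cbn [nb_mean_der]. unfold kA.
      change (match r with O => 1 | S _ => INR r + 1 end) with (INR (S r)). rewrite S_INR.
      field. lra.
    + apply is_derive_scal. exact I1.
Qed.

Lemma nb_mean_der_ext (r : nat) (A B : nat -> R) (y : R) : 0 < y -> poly_growth A ->
  (forall k, A k = B k) -> nb_mean_der r A y = nb_mean_der r B y.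
Proof.
  intros Hy HA HAB. rewrite !nb_mean_der_eq; auto.
  - apply nb_mean_ext. intros k. now rewrite HAB.
  - apply (poly_growth_le _ A); auto. intros k. rewrite HAB. lra.
Qed.

Lemma nb_mean_der_plus (r : nat) (A B : nat -> R) (y : R) : 0 < y -> poly_growth A -> poly_growth
    B ->
  nb_mean_der r (fun k => A k + B k) y = nb_mean_der r A y + nb_mean_der r B y.
Proof.
  intros Hy HA HB. rewrite !nb_mean_der_eq; auto; [|now apply poly_growth_plus].
  rewrite <- nb_mean_plus; auto; try (apply poly_growth_mult; auto; apply poly_growth_nb_score).
  apply nb_mean_ext. intros k. ring.
Qed.

Lemma nb_mean_der_scal (r : nat) (a : R) (A : nat -> R) (y : R) : 0 < y -> poly_growth A ->
  nb_mean_der r (fun k => a * A k) y = a * nb_mean_der r A y.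
Proof.
  intros Hy HA. rewrite !nb_mean_der_eq; auto.
  - rewrite <- nb_mean_scal. apply nb_mean_ext. intros k. ring.
  - apply (poly_growth_mult (fun _ => a)); [apply poly_growth_const | auto].
Qed.

Lemma nb_mean_der_one (r : nat) (y : R) : 0 < y ->
  nb_mean_der r (fun _ => 1) y = match r with O => 1 | S _ => 0 end.
Proof.
  revert y. induction r as [|r IH]; intros y Hy; [now apply nb_mean_one|].
  assert (H := is_derive_nb_mean_der r _ y Hy (poly_growth_const 1)).
  apply is_derive_unique in H. rewrite <- H.
  rewrite (Derive_ext_loc _ (fun _ => match r with O => 1 | S _ => 0 end)); [apply Derive_const|].
  exists (mkposreal y Hy). intros z Hz. change (Rabs (z - y) < y) in Hz.
  apply Rabs_def2 in Hz. apply IH. lra.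
Qed.

End Expectation.

(** * Exponential moments and estimates uniform in n *)

Lemma exp_le_quadratic (t : R) : Rabs t <= 1 / 2 -> exp t <= 1 + t + 2 * t ^ 2.
Proof.
  intros Ht. apply Rabs_le_between in Ht.
  assert (H1 : exp t * exp (- t) = 1) by (rewrite <- exp_plus, <- exp_0; f_equal; ring).
  assert (H2 := exp_ineq1_le (- t)). assert (H3 := exp_pos t). nra.
Qed.

(** Equivalent to 1 <= (1 - w) exp(w + 2 w^2), which follows from exp v >= 1 + v and (1 - w)(1 + w +
    2 w^2) = 1 + w^2 (1 - 2 w). *)
Lemma ln_1_minus_ge (w : R) : Rabs w <= 1 / 2 -> - w - 2 * w ^ 2 <= ln (1 - w).
Proof.
  intros Hw. apply Rabs_le_between in Hw.
  rewrite <- (ln_exp (- w - 2 * w ^ 2)). apply ln_le; [apply exp_pos|].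
  assert (H1 : exp (w + 2 * w ^ 2) * exp (- w - 2 * w ^ 2) = 1)
    by (rewrite <- exp_plus, <- exp_0; f_equal; ring).
  assert (H2 := exp_ineq1_le (w + 2 * w ^ 2)). assert (H3 := exp_pos (- w - 2 * w ^ 2)).
  assert (1 <= (1 - w) * (1 + w + 2 * w ^ 2)) by nra.
  assert (1 <= (1 - w) * exp (w + 2 * w ^ 2)) by nra.
  apply Rle_trans with (((1 - w) * exp (w + 2 * w ^ 2)) * exp (- w - 2 * w ^ 2)); [nra|].
  rewrite Rmult_assoc, H1. lra.
Qed.

(** With D = e^t - 1 the mean is e^(-t n x) (1 - g x D)^(-n/g). To first order the logarithm of the
    second factor is n x D, hence n x t, which the centring cancels. Left over are 2 x t^2 from D <=
    t + 2 t^2 and 8 g x^2 t^2 from 2 g x^2 D^2 with |D| <= 2 |t|, both times n. *)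
Lemma exp_moment_bound (n g x t : R) :
  0 < n -> 0 < g -> 0 < x -> Rabs t <= 1 / 2 -> 2 * (g * x) * Rabs t <= 1 / 2 ->
  exists V, is_series (fun k => nb_prob (n / g) g k x * exp (t * (INR k - n * x))) V /\
            V <= exp (n * t ^ 2 * (2 * x + 8 * g * x ^ 2)).
Proof.
  intros Hn Hg Hx Ht Hgt. assert (Hgx : 0 < g * x) by nra.
  set (D := exp t - 1).
  assert (HD1 : t <= D) by (unfold D; assert (H := exp_ineq1_le t); lra).
  assert (HD2 : D <= t + 2 * t ^ 2) by (unfold D; assert (H := exp_le_quadratic t Ht); lra).
  assert (HD : Rabs D <= 2 * Rabs t).
  { assert (t ^ 2 <= Rabs t * (1 / 2)).
    { rewrite <- (pow2_abs t). assert (H := Rabs_pos t). nra. }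
    assert (Ha := Rle_abs t). assert (Hb := Rle_abs (- t)). rewrite Rabs_Ropp in Hb.
    apply Rabs_le. lra. }
  assert (Hw : Rabs (g * x * D) <= 1 / 2) by (rewrite Rabs_mult, (Rabs_pos_eq (g * x)); nra).
  assert (Hlt : g * x * D < 1) by (apply Rabs_le_between in Hw; lra).
  assert (Hc : 0 < n / g) by (now apply Rdiv_lt_0_compat).
  assert (Hs := is_series_exp_moment (n / g) g Hc Hg x (exp t) Hx (Rlt_le _ _ (exp_pos t)) Hlt).
  fold D in Hs.
  exists (exp (- t * n * x) * Rpower (1 - g * x * D) (- (n / g))). split.
  - apply is_series_ext with (fun k => exp (- t * n * x) * (nb_prob (n / g) g k x * exp t ^ k)).
    + intros k. rewrite <- (Rpower_pow k (exp t)) by apply exp_pos. unfold Rpower.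
      rewrite ln_exp. replace (t * (INR k - n * x)) with (- t * n * x + INR k * t) by ring.
      rewrite exp_plus. simpl. ring.
    + now apply (is_series_scal_l (K := R_AbsRing) (V := R_NormedModule) (exp (- t * n * x))
        (fun k => nb_prob (n / g) g k x * exp t ^ k)).
  - unfold Rpower. rewrite <- exp_plus.
    assert (HL := ln_1_minus_ge _ Hw).
    assert (E1 : - (n / g) * ln (1 - g * x * D) <= n * (x * D + 2 * g * x ^ 2 * D ^ 2)).
    { replace (n * (x * D + 2 * g * x ^ 2 * D ^ 2))
        with ((n / g) * (g * x * D + 2 * (g * x * D) ^ 2)) by (field; lra). nra. }
    assert (E2 : D ^ 2 <= 4 * t ^ 2).
    { rewrite <- (pow2_abs D), <- (pow2_abs t). assert (H := Rabs_pos D). nra. }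
    assert (E3 : x * D + 2 * g * x ^ 2 * D ^ 2 <= x * (t + 2 * t ^ 2) + 8 * g * x ^ 2 * t ^ 2).
    { assert (0 < g * x ^ 2) by nra. nra. }
    assert (E4 : - t * n * x + - (n / g) * ln (1 - g * x * D) <= n * t ^ 2 * (2 * x + 8 * g * x ^
        2)) by nra.
    destruct E4 as [E4|E4]; [left; now apply exp_increasing | rewrite E4; lra].
Qed.

(* Powers are dominated by exp (+-(k - n x) / q), whose means stay bounded when q^2 = n. *)
Lemma standardized_moment_bound (g x : R) (M : nat) : 0 < g -> 0 < x ->
  exists C q0, 0 < C /\ 1 <= q0 /\ forall q, q0 <= q ->
    nb_mean (q ^ 2 / g) g (fun k => (1 + Rabs (INR k - q ^ 2 * x) / q) ^ M) x <= C.
Proof.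
  intros Hg Hx. assert (Hgx : 0 < g * x) by nra.
  set (B := exp (2 * x + 8 * g * x ^ 2)). set (F := INR (fact M) * exp 1).
  assert (HF : 0 < F) by (apply Rmult_lt_0_compat; [apply INR_fact_lt_0 | apply exp_pos]).
  (* With |t| = 1/q, the conditions q >= 2 and q >= 4 g x are the two smallness hypotheses of
     [exp_moment_bound]. The two summands B belong to the two signs of t. *)
  exists (F * (B + B)), (2 + 4 * (g * x)).
  assert (HB : 0 < B) by apply exp_pos. split; [nra|]. split; [lra|].
  intros q Hq. assert (Hq2 : 0 < q ^ 2) by nra.
  assert (Hqi : 0 < / q) by (apply Rinv_0_lt_compat; lra).
  assert (Hqq : / q * q = 1) by (field; lra).
  assert (Hs : forall t, Rabs t = / q -> exists V, is_series
      (fun k => nb_prob (q ^ 2 / g) g k x * exp (t * (INR k - q ^ 2 * x))) V /\ V <= B).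
  { intros t Ht.
    destruct (exp_moment_bound (q ^ 2) g x t) as [V [HV1 HV2]]; auto; rewrite ?Ht; try nra.
    exists V. split; auto. eapply Rle_trans; [apply HV2|]. unfold B.
    rewrite <- (pow2_abs t), Ht. replace (q ^ 2 * (/ q) ^ 2) with 1 by (field; lra).
    right; f_equal; ring. }
  destruct (Hs (/ q)) as [V1 [HV1 HB1]]; [apply Rabs_pos_eq; lra|].
  destruct (Hs (- / q)) as [V2 [HV2 HB2]]; [rewrite Rabs_Ropp; apply Rabs_pos_eq; lra|].
  assert (HS := is_series_scal_l (K := R_AbsRing) (V := R_NormedModule) F _ _
     (is_series_plus (K := R_AbsRing) (V := R_NormedModule) _ _ _ _ HV1 HV2)).
  unfold scal, plus in HS; simpl in HS. unfold mult in HS; simpl in HS.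
  apply Rle_trans with (F * (V1 + V2)); [|nra].
  rewrite <- (is_series_unique _ _ HS). unfold nb_mean.
  apply Series_le; [|eexists; apply HS].
  intros k. set (u := INR k - q * (q * 1) * x). change (q ^ 2) with (q * (q * 1)). fold u.
  assert (Hp : 0 < nb_prob (q * (q * 1) / g) g k x).
  { apply nb_prob_pos; auto. apply Rdiv_lt_0_compat; auto. }
  assert (Hv : 0 <= Rabs u / q) by (apply Rmult_le_pos; [apply Rabs_pos | lra]).
  split; [apply Rmult_le_pos; [lra | apply pow_le; lra]|].
  assert (H1 := pow_le_fact_exp M (1 + Rabs u / q) ltac:(lra)).
  rewrite exp_plus in H1.
  assert (H2 : exp (Rabs u / q) <= exp (/ q * u) + exp (- / q * u)).
  { assert (P1 := exp_pos (/ q * u)). assert (P2 := exp_pos (- / q * u)).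
    unfold Rabs. destruct (Rcase_abs u).
    - replace (- u / q) with (- / q * u) by (field; lra). lra.
    - replace (u / q) with (/ q * u) by (field; lra). lra. }
  replace (F * (nb_prob (q * (q * 1) / g) g k x * exp (/ q * u) + nb_prob (q * (q * 1) / g) g k x
      * exp (- / q * u)))
    with (nb_prob (q * (q * 1) / g) g k x * (F * (exp (/ q * u) + exp (- / q * u)))) by ring.
  apply Rmult_le_compat_l; [lra|].
  eapply Rle_trans; [apply H1|]. unfold F. rewrite Rmult_assoc.
  apply Rmult_le_compat_l; [apply pos_INR|]. apply Rmult_le_compat_l; [left; apply exp_pos | auto].
Qed.

(** Grade by T = q + |k - n x|: one step of the recurrence multiplies the score of order r by a
    quantity O(T), and the score of order r - 1 by r (n + g (r - 1)) = O(T^2), because n = q^2. Each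
    order thus costs one factor T. *)
Lemma nb_score_bound (g x : R) (r : nat) : 0 < g -> 0 < x ->
  exists C, 0 <= C /\ forall q k, 1 <= q ->
    Rabs (nb_score (q ^ 2 / g) g x r k) <= C * (q * (1 + Rabs (INR k - q ^ 2 * x) / q)) ^ r.
Proof.
  intros Hg Hx. assert (Hgx : 0 < g * x) by nra.
  enough (H : (exists C, 0 <= C /\ forall q k, 1 <= q ->
      Rabs (nb_score (q ^ 2 / g) g x r k) <= C * (q * (1 + Rabs (INR k - q ^ 2 * x) / q)) ^ r) /\
    (exists C, 0 <= C /\ forall q k, 1 <= q ->
      Rabs (nb_score (q ^ 2 / g) g x (pred r) k) <= C * (q * (1 + Rabs (INR k - q ^ 2 * x) / q))
          ^ pred r)) by apply H.
  induction r as [|r [[C1 [HC1 IH1]] [C2 [HC2 IH2]]]].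
  - assert (B : exists C, 0 <= C /\ forall q k, 1 <= q ->
      Rabs (nb_score (q ^ 2 / g) g x 0 k) <= C * (q * (1 + Rabs (INR k - q ^ 2 * x) / q)) ^ 0).
    { exists 1. split; [lra|]. intros q k _. simpl. rewrite Rabs_R1. lra. }
    now split.
  - split; [|exists C1; auto]. clear -IH1 IH2 HC1 HC2 Hgx Hg Hx.
    set (phi := x * (1 + g * x)). assert (Hphi : 0 < phi) by (unfold phi; nra).
    assert (Hr := pos_INR r).
    set (a := INR r * (1 + 2 * g * x)). assert (Ha : 0 <= a) by (unfold a; nra).
    set (b := INR r * (1 + g * Rabs (INR r - 1))).
    assert (Hr1 := Rabs_pos (INR r - 1)). assert (Hb : 0 <= b) by (apply Rmult_le_pos; nra).
    exists (((1 + a) * C1 + b * C2) / phi). split.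
    { apply Rmult_le_pos; [nra | left; now apply Rinv_0_lt_compat]. }
    intros q k Hq. specialize (IH1 q k Hq). specialize (IH2 q k Hq).
    set (u := INR k - q ^ 2 * x) in *. set (T := q * (1 + Rabs u / q)) in *.
    assert (HT : T = q + Rabs u) by (unfold T; field; lra).
    assert (Hu := Rabs_pos u).
    cbn [nb_score]. fold phi.
    replace (g * (q ^ 2 / g)) with (q ^ 2) by (field; lra).
    set (Q1 := nb_score (q ^ 2 / g) g x r k) in *.
    set (Q2 := nb_score (q ^ 2 / g) g x (pred r) k) in *.
    assert (N1 : Rabs ((INR k - (q ^ 2 * x + INR r * (1 + 2 * g * x))) * Q1) <= (1 + a) * C1 * T
        ^ S r).
    { rewrite Rabs_mult.
      assert (Rabs (INR k - (q ^ 2 * x + INR r * (1 + 2 * g * x))) <= (1 + a) * T).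
      { replace (INR k - (q ^ 2 * x + INR r * (1 + 2 * g * x))) with (u + - a) by (unfold u, a;
          ring).
        eapply Rle_trans; [apply Rabs_triang|]. rewrite Rabs_Ropp, (Rabs_pos_eq a) by auto. nra. }
      replace ((1 + a) * C1 * T ^ S r) with ((1 + a) * T * (C1 * T ^ r)) by (simpl; ring).
      apply Rmult_le_compat; auto; apply Rabs_pos. }
    assert (N2 : Rabs (INR r * (q ^ 2 + g * (INR r - 1)) * Q2) <= b * C2 * T ^ S r).
    { destruct r as [|r']; [simpl; rewrite !Rmult_0_l, Rabs_R0; unfold b; simpl; lra|].
      set (r := S r') in *.
      rewrite Rabs_mult.
      assert (Rabs (INR r * (q ^ 2 + g * (INR r - 1))) <= b * T ^ 2).
      { rewrite Rabs_mult, (Rabs_pos_eq (INR r)) by auto. unfold b. rewrite Rmult_assoc.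
        apply Rmult_le_compat_l; auto.
        eapply Rle_trans; [apply Rabs_triang|].
        rewrite Rabs_mult, (Rabs_pos_eq g), Rabs_pos_eq by nra.
        assert (q ^ 2 <= T ^ 2) by nra. assert (1 <= T ^ 2) by nra.
        assert (0 <= g * Rabs (INR r - 1)) by nra. nra. }
      replace (b * C2 * T ^ S r) with (b * T ^ 2 * (C2 * T ^ pred r)) by (unfold r; simpl; ring).
      apply Rmult_le_compat; auto; apply Rabs_pos. }
    unfold Rdiv at 1. rewrite Rabs_mult, Rabs_inv, (Rabs_pos_eq phi) by lra.
    replace (((1 + a) * C1 + b * C2) / phi * T ^ S r)
      with (((1 + a) * C1 * T ^ S r + b * C2 * T ^ S r) * / phi) by (field; lra).
    apply Rmult_le_compat_r; [left; now apply Rinv_0_lt_compat|].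
    unfold Rminus at 1. eapply Rle_trans; [apply Rabs_triang|]. rewrite Rabs_Ropp. lra.
Qed.

(** * The weight functionals *)

Lemma p_nkg_nb_prob (n k : nat) (g x : R) : 0 < g -> 1 <= INR n / g ->
  p_nkg n k g x = nb_prob (INR n / g) g k x.
Proof.
  intros Hg Hc. unfold p_nkg, nb_prob. f_equal. set (c := INR n / g) in *. unfold nb_coef.
  assert (HGc := Gamma_pos c Hc).
  assert (H1 : Gamma (INR k + 1) = INR (fact k)).
  { induction k as [|k IH].
    - simpl. rewrite Rplus_0_l. apply Gamma_1.
    - rewrite S_INR, Gamma_succ, IH, fact_simpl, mult_INR, S_INR; [ring|].
      assert (H := pos_INR k). lra. }
  assert (H2 : Gamma (c + INR k) = poch c k * Gamma c).
  { clear H1. induction k as [|k IH].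
    - simpl. rewrite Rplus_0_r. ring.
    - rewrite S_INR, <- Rplus_assoc, Gamma_succ, IH; [simpl; ring|].
      assert (H := pos_INR k). lra. }
  rewrite H1, H2. assert (H := INR_fact_lt_0 k). field. lra.
Qed.

Definition bconst (c g : R) (j : nat) : R :=
  g * Gamma (c + INR (S j) + 1) / (Gamma (INR (S j)) * Gamma (c + 1)).

Lemma bconst_pos (c g : R) (j : nat) : 0 < c -> 0 < g -> 0 < bconst c g j.
Proof.
  intros Hc Hg. unfold bconst. assert (H := pos_INR j). rewrite S_INR.
  apply Rdiv_lt_0_compat; apply Rmult_lt_0_compat; auto; apply Gamma_pos; lra.
Qed.

Lemma bconst_0 (c g : R) : 0 < c -> bconst c g 0 = g * (c + 1).
Proof.
  intros Hc. unfold bconst. simpl INR. rewrite Gamma_1, Gamma_succ by lra.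
  assert (H := Gamma_pos (c + 1)). field. lra.
Qed.

(** This ratio lets the kernels be normalized by induction in [is_weight_one], in place of a Beta
    integral. *)
Lemma bconst_S (c g : R) (j : nat) : 0 < c ->
  bconst c g (S j) = bconst c g j * ((c + INR j + 2) / (INR j + 1)).
Proof.
  intros Hc. unfold bconst. assert (H := pos_INR j). rewrite !S_INR.
  replace (c + (INR j + 1 + 1) + 1) with ((c + (INR j + 1) + 1) + 1) by ring.
  rewrite (Gamma_succ (c + (INR j + 1) + 1)), (Gamma_succ (INR j + 1)) by lra.
  assert (H1 := Gamma_pos (INR j + 1)). assert (H2 := Gamma_pos (c + 1)). field. lra.
Qed.

Lemma b_nkg_eq (n j : nat) (g t : R) : 0 < 1 + g * t ->
  b_nkg n (S j) g t =
  bconst (INR n / g) g j * ((g * t) ^ j * Rpower (1 + g * t) (- (INR n / g + INR j + 2))).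
Proof.
  intros Ht. unfold b_nkg, bconst. f_equal. replace (S j - 1)%nat with j by lia.
  rewrite Rpower_Ropp. unfold Rdiv at 1. do 3 f_equal. rewrite S_INR. ring.
Qed.

(** At 0 the function h is continuous from the right only. Composing with [Rmax 0] gives a two-sided
    continuous function with the same values on the half-line, as the integrability lemma
    demands. *)
Lemma continuous_Rmax_0_comp (h : R -> R) (t : R) :
  cont_on_halfline h -> continuous (fun t => h (Rmax 0 t)) t.
Proof.
  intros Hh. unfold continuous.
  eapply filterlim_comp; [|apply (Hh (Rmax 0 t) (Rmax_l 0 t))].
  intros P [eps HP]. exists eps. intros u Hu. apply HP; [|apply Rmax_l].
  change (Rabs (Rmax 0 u - Rmax 0 t) < eps). change (Rabs (u - t) < eps) in Hu.
  eapply Rle_lt_trans; [|apply Hu]. unfold Rmax.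
  destruct (Rle_dec 0 u), (Rle_dec 0 t); apply Rabs_le; unfold Rabs;
      destruct (Rcase_abs (u - t)); lra.
Qed.

Section Durrmeyer.
Variables (n : nat) (g : R).
Let c := INR n / g.
Hypotheses (Hg : 0 < g) (Hc : 0 < c).

(* [v] is the value at [h] of the k-th weight functional of the operator; for k = 0 this is
   evaluation at 0. *)
Definition is_weight (k : nat) (h : R -> R) (v : R) : Prop :=
  match k with
  | O => v = h 0
  | S _ => is_RInt_gen (fun t => b_nkg n k g t * h t) (at_point 0) (Rbar_locally p_infty) v
  end.

Lemma is_weight_ext (k : nat) (h1 h2 : R -> R) (v : R) :
  (forall t, 0 <= t -> h1 t = h2 t) -> is_weight k h1 v -> is_weight k h2 v.
Proof.
  intros H. destruct k as [|j]; simpl; [intros ->; apply H; lra|].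
  apply is_RInt_gen_ext. apply Filter_prod with (fun s => s = 0) (fun t => 0 < t).
  - easy.
  - now exists 0.
  - intros s t -> Ht u. simpl. rewrite Rmin_left by lra. intros Hu. rewrite H by lra. reflexivity.
Qed.

Lemma is_weight_plus (k : nat) (h1 h2 : R -> R) (v1 v2 : R) :
  is_weight k h1 v1 -> is_weight k h2 v2 -> is_weight k (fun t => h1 t + h2 t) (v1 + v2).
Proof.
  destruct k as [|j]; simpl; [intros -> ->; auto|]. intros H1 H2.
  assert (H := is_RInt_gen_plus _ _ _ _ H1 H2). revert H. apply is_RInt_gen_ext.
  apply filter_forall. intros ab t _. unfold plus; simpl. ring.
Qed.

Lemma is_weight_scal (k : nat) (a : R) (h : R -> R) (v : R) :
  is_weight k h v -> is_weight k (fun t => a * h t) (a * v).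
Proof.
  destruct k as [|j]; simpl; [intros ->; auto|]. intros H1.
  assert (H := is_RInt_gen_scal _ a _ H1). revert H. apply is_RInt_gen_ext.
  apply filter_forall. intros ab t _. unfold scal; simpl. unfold mult; simpl. ring.
Qed.

Lemma b_nkg_nonneg (j : nat) (t : R) : 0 <= t -> 0 <= b_nkg n (S j) g t.
Proof.
  intros Ht. assert (0 <= g * t) by nra. rewrite b_nkg_eq by lra.
  apply Rmult_le_pos; [left; now apply bconst_pos|].
  apply Rmult_le_pos; [now apply pow_le | left; apply exp_pos].
Qed.

Lemma is_weight_nonneg (k : nat) (h : R -> R) (v : R) :
  (forall t, 0 <= t -> 0 <= h t) -> is_weight k h v -> 0 <= v.
Proof.
  intros Hh. destruct k as [|j]; simpl; [intros ->; apply Hh; lra|]. intros Hv.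
  eapply Rle_trans; [apply (norm_ge_0 v)|].
  apply (RInt_gen_norm (V := R_CompleteNormedModule) (Fa := at_point 0) (Fb := Rbar_locally p_infty)
    (fun t => b_nkg n (S j) g t * h t) (fun t => b_nkg n (S j) g t * h t) v v);
        [| |exact Hv|exact Hv].
  - apply Filter_prod with (fun s => s = 0) (fun t => 0 < t); [easy | now exists 0|].
    intros s t -> Ht. simpl. lra.
  - apply Filter_prod with (fun s => s = 0) (fun t => 0 < t); [easy | now exists 0|].
    intros s t -> Ht u. simpl. intros Hu. right. apply Rabs_pos_eq.
    apply Rmult_le_pos; [apply b_nkg_nonneg | apply Hh]; lra.
Qed.

Lemma is_weight_le (k : nat) (h1 h2 : R -> R) (v1 v2 : R) :
  (forall t, 0 <= t -> h1 t <= h2 t) -> is_weight k h1 v1 -> is_weight k h2 v2 -> v1 <= v2.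
Proof.
  intros H H1 H2.
  assert (H3 := is_weight_plus _ _ _ _ _ H2 (is_weight_scal _ (-1) _ _ H1)).
  apply is_weight_nonneg in H3; [lra|]. intros t Ht. specialize (H t Ht). lra.
Qed.

(** The power (g t)^j is compensated by the j in the exponent of 1 + g t, so every kernel decays
    like t^-(c+2), independently of j. The constant comes from 1 + t <= (1 + 1/g)(1 + g t). *)
Lemma b_nkg_decay (j m : nat) (t : R) : 0 <= t -> INR m <= c + 2 ->
  b_nkg n (S j) g t * (1 + t) ^ m <= bconst c g j * (1 + / g) ^ m.
Proof.
  intros Ht Hm. assert (Hgt : 0 <= g * t) by nra.
  rewrite b_nkg_eq, Rmult_assoc by lra. fold c.
  apply Rmult_le_compat_l; [left; now apply bconst_pos|].
  set (e := Rpower (1 + g * t) (- (c + INR j + 2))).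
  assert (He : 0 < e) by apply exp_pos.
  assert (Hi : 0 < / g) by now apply Rinv_0_lt_compat.
  assert (H1 : (g * t) ^ j <= (1 + g * t) ^ j) by (apply pow_incr; lra).
  assert (H2 : (1 + t) ^ m <= (1 + / g) ^ m * (1 + g * t) ^ m).
  { rewrite <- Rpow_mult_distr. apply pow_incr.
    replace ((1 + / g) * (1 + g * t)) with (1 + t + / g + g * t) by (field; lra). lra. }
  assert (H3 : (1 + g * t) ^ j * e * (1 + g * t) ^ m <= 1).
  { rewrite <- !Rpower_pow by lra. unfold e. rewrite <- !Rpower_plus.
    apply Rle_trans with (Rpower (1 + g * t) 0); [apply Rle_Rpower; lra | rewrite Rpower_O; lra]. }
  assert (P1 : 0 <= (1 + / g) ^ m) by (apply pow_le; lra).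
  assert (P2 : 0 <= (1 + t) ^ m) by (apply pow_le; lra).
  assert (P3 : 0 <= (g * t) ^ j) by (now apply pow_le).
  assert (P4 : 0 <= (1 + g * t) ^ j) by (apply pow_le; lra).
  apply Rle_trans with ((1 + g * t) ^ j * e * ((1 + / g) ^ m * (1 + g * t) ^ m)).
  - apply Rmult_le_compat; auto; [apply Rmult_le_pos; lra | apply Rmult_le_compat_r; lra].
  - replace ((1 + g * t) ^ j * e * ((1 + / g) ^ m * (1 + g * t) ^ m))
      with ((1 + / g) ^ m * ((1 + g * t) ^ j * e * (1 + g * t) ^ m)) by ring.
    rewrite <- (Rmult_1_r ((1 + / g) ^ m)) at 2. now apply Rmult_le_compat_l.
Qed.

(** A function whose derivative combines two consecutive kernels, up to constants. It drives both
    the normalization of the kernels and the recurrence for their moments. *)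
Lemma is_derive_b_nkg_primitive (j : nat) (t : R) : 0 < 1 + g * t ->
  is_derive (fun t => (g * t) ^ S j * Rpower (1 + g * t) (- (c + INR j + 2))) t
    (g * (INR j + 1) * ((g * t) ^ j * Rpower (1 + g * t) (- (c + INR j + 2)))
     - g * (c + INR j + 2) * ((g * t) ^ S j * Rpower (1 + g * t) (- (c + INR (S j) + 2)))).
Proof.
  intros Ht. rewrite S_INR.
  replace (- (c + (INR j + 1) + 2)) with (- (c + INR j + 2) + - (1)) by ring.
  rewrite Rpower_plus, (Rpower_Ropp _ 1), Rpower_1 by auto.
  replace (g * (INR j + 1)) with (g * INR (S j)) by (rewrite S_INR; ring).
  unfold Rpower. auto_derive; [lra|].
  change (match j with O => 1 | S _ => INR j + 1 end) with (INR (S j)). rewrite S_INR.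
  simpl pow. field. lra.
Qed.

Lemma continuous_b_nkg (j : nat) (t : R) : 0 <= t -> continuous (b_nkg n (S j) g) t.
Proof.
  intros Ht. assert (0 <= g * t) by nra.
  apply (ex_derive_continuous (b_nkg n (S j) g)). unfold b_nkg, Rpower.
  auto_derive. split; [lra|]. split; auto. apply Rgt_not_eq, exp_pos.
Qed.

Lemma is_weight_exists (k m : nat) (h : R -> R) (B : R) :
  cont_on_halfline h -> (forall t, 0 <= t -> Rabs (h t) <= B * (1 + t) ^ m) -> INR m <= c ->
  exists v, is_weight k h v.
Proof.
  intros Hh HB Hm. destruct k as [|j]; [now exists (h 0)|]. simpl.
  assert (HB0 : 0 <= B).
  { specialize (HB 0 (Rle_refl 0)). rewrite Rplus_0_r, pow1 in HB. assert (H := Rabs_pos (h 0)).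
    lra. }
  (* The kernel decays to order c + 2; growth of order m <= c leaves the two orders that the
     majorant asks for. *)
  apply ex_RInt_gen_dominated with (fun t => 0 <= t) (B * (bconst c g j * (1 + / g) ^ (m + 2))).
  - apply at_point_filter.
  - unfold at_point. lra.
  - intros eps. unfold at_point. apply eps.
  - intros; lra.
  - auto.
  - intros u w Hu Hw.
    apply (ex_RInt_ext (V := R_NormedModule) (fun t => b_nkg n (S j) g t * h (Rmax 0 t))).
    + intros t [Ht _]. rewrite Rmax_right; auto. revert Ht. apply Rmin_case; lra.
    + apply (ex_RInt_continuous (V := R_CompleteNormedModule)). intros t [Ht _].
      apply (continuous_mult (K := R_AbsRing)); [|now apply continuous_Rmax_0_comp].
      apply continuous_b_nkg. revert Ht. apply Rmin_case; lra.
  - intros t Ht. apply -> Rle_div_r; [|apply pow_lt; lra].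
    rewrite Rabs_mult, (Rabs_pos_eq (b_nkg n (S j) g t)) by now apply b_nkg_nonneg.
    assert (H1 := b_nkg_decay j (m + 2) t Ht). rewrite plus_INR in H1. simpl INR in H1.
    specialize (H1 ltac:(lra)). rewrite pow_add in H1.
    assert (H2 := b_nkg_nonneg j t Ht). assert (H3 : 0 <= (1 + t) ^ 2) by nra.
    apply Rle_trans with (B * (b_nkg n (S j) g t * ((1 + t) ^ m * (1 + t) ^ 2))).
    + replace (b_nkg n (S j) g t * Rabs (h t) * (1 + t) ^ 2)
        with ((b_nkg n (S j) g t * (1 + t) ^ 2) * Rabs (h t)) by ring.
      replace (B * (b_nkg n (S j) g t * ((1 + t) ^ m * (1 + t) ^ 2)))
        with ((b_nkg n (S j) g t * (1 + t) ^ 2) * (B * (1 + t) ^ m)) by ring.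
      apply Rmult_le_compat_l; [now apply Rmult_le_pos | auto].
    + now apply Rmult_le_compat_l.
Qed.

(** Induction on the kernels. The first has an explicit primitive; afterwards the function of
    [is_derive_b_nkg_primitive] vanishes at both ends, so the integrals of consecutive kernels are
    proportional. *)
Lemma is_weight_one (k : nat) : is_weight k (fun _ => 1) 1.
Proof.
  destruct k as [|j]; [reflexivity|].
  set (f := fun j t => (g * t) ^ j * Rpower (1 + g * t) (- (c + INR j + 2))).
  assert (Hf0 : forall j, is_weight (S j) (fun _ => 1) 1 <->
     is_RInt_gen (fun t => bconst c g j * f j t) (at_point 0) (Rbar_locally p_infty) 1).
  { intros i. simpl. split; apply is_RInt_gen_ext;
    (apply Filter_prod with (fun s => s = 0) (fun t => 0 < t); [easy | now exists 0|];
     intros s t -> Ht u; simpl; rewrite Rmin_left by lra; intros Hu;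
     rewrite b_nkg_eq by nra; unfold f, c; simpl; ring). }
  assert (Hlim : forall i e, c + 1 <= e -> filterlim (fun t => (g * t) ^ i * Rpower (1 + g * t)
      (- (e + INR i)))
                 (Rbar_locally p_infty) (locally 0)).
  { intros i e He. apply filterlim_0_dominated_inv with (1 + / g). intros t Ht.
    assert (Hgt : 0 < g * t) by nra. assert (Hi : 0 < / g) by now apply Rinv_0_lt_compat.
    rewrite Rabs_pos_eq by (apply Rmult_le_pos; [apply pow_le; lra | left; apply exp_pos]).
    apply -> Rle_div_r; [|lra].
    assert (H1 : (g * t) ^ i <= Rpower (1 + g * t) (INR i))
      by (rewrite Rpower_pow by lra; apply pow_incr; lra).
    assert (H2 : Rpower (1 + g * t) (INR i) * Rpower (1 + g * t) (- (e + INR i)) <= / (1 + g * t)).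
    { rewrite <- Rpower_plus. rewrite <- (Rpower_1 (1 + g * t)) at 2 by lra. rewrite <- Rpower_Ropp.
      apply Rle_Rpower; lra. }
    assert (H3 : 1 + t <= (1 + / g) * (1 + g * t)).
    { replace ((1 + / g) * (1 + g * t)) with (1 + t + / g + g * t) by (field; lra). lra. }
    assert (Hp := exp_pos (- (e + INR i) * ln (1 + g * t))).
    fold (Rpower (1 + g * t) (- (e + INR i))) in Hp.
    apply Rle_trans with (/ (1 + g * t) * ((1 + / g) * (1 + g * t))).
    - apply Rmult_le_compat; try lra.
      + apply Rmult_le_pos; [apply pow_le; lra | lra].
      + eapply Rle_trans; [|apply H2]. apply Rmult_le_compat_r; lra.
    - right. field. lra. }
  induction j as [|j IH].
  - apply (proj2 (Hf0 0%nat)). rewrite bconst_0 by auto.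
    cut (is_RInt_gen (fun t => g * (c + 1) * f 0%nat t) (at_point 0) (Rbar_locally p_infty) (0 -
        -1)).
    { now replace (0 - -1) with 1 by ring. }
    apply is_RInt_gen_primitive with (fun t => 0 <= t) (fun t => - ((g * t) ^ 0 * Rpower (1 + g *
        t) (- (c + 1 + INR 0)))).
    + apply at_point_filter.
    + unfold at_point. lra.
    + intros; lra.
    + intros t Ht. assert (0 <= g * t) by nra. unfold f. simpl INR.
      replace (- (c + 0 + 2)) with (- (c + 1 + 0) + - (1)) by ring.
      rewrite Rpower_plus, (Rpower_Ropp _ 1), Rpower_1 by lra.
      unfold Rpower. auto_derive; [lra | simpl; field; lra].
    + intros t Ht. assert (0 <= g * t) by nra.
      apply (ex_derive_continuous (fun t => g * (c + 1) * f 0%nat t)).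
      unfold f, Rpower. auto_derive. lra.
    + intros P HP. apply locally_singleton in HP. unfold filtermap, at_point.
      replace (- ((g * 0) ^ 0 * Rpower (1 + g * 0) (- (c + 1 + INR 0)))) with (-1); [exact HP|].
      replace (1 + g * 0) with 1 by ring. unfold Rpower. rewrite pow_O, ln_1, Rmult_0_r, exp_0.
      ring.
    + rewrite <- Ropp_0. eapply filterlim_comp; [apply (Hlim 0%nat);
        lra | apply (filterlim_opp (V := R_NormedModule))].
  - apply (proj2 (Hf0 (S j))). apply (proj1 (Hf0 j)) in IH.
    assert (Hj := pos_INR j).
    assert (H0 : is_RInt_gen (fun t => g * (INR j + 1) * f j t - g * (c + INR j + 2) * f (S j) t)
       (at_point 0) (Rbar_locally p_infty) (0 - 0)).
    { apply is_RInt_gen_primitive with (fun t => 0 <= t)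
        (fun t => (g * t) ^ S j * Rpower (1 + g * t) (- (c + INR j + 2))).
      - apply at_point_filter.
      - unfold at_point. lra.
      - intros; lra.
      - intros t Ht. apply is_derive_b_nkg_primitive. nra.
      - intros t Ht. assert (0 <= g * t) by nra.
        apply (ex_derive_continuous (fun t => g * (INR j + 1) * f j t - g * (c + INR j + 2) * f
            (S j) t)).
        unfold f, Rpower. auto_derive. lra.
      - intros P HP. apply locally_singleton in HP. unfold filtermap, at_point.
        rewrite Rmult_0_r, pow_i, Rmult_0_l by lia. exact HP.
      - replace (c + INR j + 2) with (c + 1 + INR (S j)) by (rewrite S_INR; ring). apply Hlim.
        lra. }
    (* The multiple is chosen to cancel the [f j] terms; what remains is [f (S j)] with the factor
       of [bconst_S]. *)
    assert (H1 := is_RInt_gen_minus _ _ _ _ IH (is_RInt_gen_scal _ (bconst c g j / (g * (INR j +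
        1))) _ H0)).
    unfold minus, plus, opp, scal in H1; simpl in H1. unfold mult in H1; simpl in H1.
    replace (1 + - (bconst c g j / (g * (INR j + 1)) * (0 - 0))) with 1 in H1 by ring.
    revert H1. apply is_RInt_gen_ext. apply filter_forall. intros ab t _.
    rewrite bconst_S by auto. match goal with |- ?x = ?y => change (@eq R x y) end. field. lra.
Qed.

End Durrmeyer.

(** * Moments of the weights *)

(* The integral of (t - y)^m against the k-th weight b.  The recurrence comes from integrating
   the derivative of  t (1 + g t) b(t) (t - y)^m, where (t (1 + g t) b)' = (k - N t) b.
   It also holds for evaluation at 0, the case k = 0. *)
Fixpoint wmoment (N g y : R) (m k : nat) : R :=
  match m with
  | O => 1
  | S m' => ((INR k - N * y + INR m' * (1 + 2 * g * y)) * wmoment N g y m' k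
             + INR m' * (y * (1 + g * y)) * wmoment N g y (pred m') k) / (N - INR m' * g)
  end.

Lemma poly_growth_wmoment (N g y : R) (m : nat) : poly_growth (wmoment N g y m).
Proof.
  enough (H : poly_growth (wmoment N g y m) /\ poly_growth (wmoment N g y (pred m))) by apply H.
  induction m as [|m [IH1 IH2]].
  - split; exact (poly_growth_const 1).
  - split; [|auto]. cbn [wmoment].
    apply (poly_growth_mult (fun k => _) (fun _ => / (N - INR m * g))); [|apply poly_growth_const].
    apply (poly_growth_plus (fun k => _) (fun k => INR m * (y * (1 + g * y)) * wmoment N g y
        (pred m) k)).
    + apply (poly_growth_mult (fun k => INR k - N * y + _)); auto.
      apply (poly_growth_plus (fun k => INR k - N * y) (fun _ => _)); [|apply poly_growth_const].
      apply (poly_growth_plus INR (fun _ => _)); [apply poly_growth_INR | apply poly_growth_const].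
    + apply (poly_growth_mult (fun _ => _)); [apply poly_growth_const | auto].
Qed.

(** The recurrence solved for the mean of k A: multiplying the sequence by k involves the orders r +
    1, r and r - 1 of A only. *)
Lemma nb_mean_der_INR_mult (c g x : R) (r : nat) (A : nat -> R) : 0 < g -> 0 < x ->
  nb_mean_der c g r (fun k => INR k * A k) x =
  x * (1 + g * x) * nb_mean_der c g (S r) A x + (g * c * x + INR r * (1 + 2 * g * x)) *
      nb_mean_der c g r A x
  + INR r * (g * c + g * (INR r - 1)) * nb_mean_der c g (pred r) A x.
Proof. intros Hg Hx. assert (0 < g * x) by nra. cbn [nb_mean_der]. field. lra. Qed.

(** If all orders above m kill A, then all orders above m + 1 kill k A, by [nb_mean_der_INR_mult];
    each step of [wmoment] multiplies by k once. *)
Lemma nb_mean_der_moment (c g N x y : R) (r m : nat) : 0 < c -> 0 < g -> 0 < x -> (m < r)%nat ->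
  nb_mean_der c g r (wmoment N g y m) x = 0.
Proof.
  intros Hc Hg Hx. assert (Hgx : 0 < g * x) by nra. revert r.
  enough (H : forall r, ((m < r)%nat -> nb_mean_der c g r (wmoment N g y m) x = 0) /\
      ((pred m < r)%nat -> nb_mean_der c g r (wmoment N g y (pred m)) x = 0)) by apply H.
  induction m as [|m IH]; intros r.
  - assert (H : (0 < r)%nat -> nb_mean_der c g r (wmoment N g y 0) x = 0).
    { intros Hr. change (wmoment N g y 0) with (fun _ : nat => 1). rewrite nb_mean_der_one by auto.
      destruct r; [lia | reflexivity]. }
    split; auto.
  - split; [|apply IH]. intros Hr. destruct r as [|r]; [lia|].
    set (u := - (N * y) + INR m * (1 + 2 * g * y)). set (v := INR m * (y * (1 + g * y))).
    assert (G1 := poly_growth_wmoment N g y m). assert (G2 := poly_growth_wmoment N g y (pred m)).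
    assert (G3 : forall a j, poly_growth (fun k => a * wmoment N g y j k)).
    { intros a j. apply (poly_growth_mult (fun _ => a));
        [apply poly_growth_const | apply poly_growth_wmoment]. }
    rewrite (nb_mean_der_ext c g Hc Hg (S r) _ (fun k => / (N - INR m * g) *
       (INR k * wmoment N g y m k + (u * wmoment N g y m k + v * wmoment N g y (pred m) k))));
      [| auto | apply poly_growth_wmoment | intros k; cbn [wmoment]; unfold u, v, Rdiv; ring].
    rewrite nb_mean_der_scal, !nb_mean_der_plus, !nb_mean_der_scal;
        auto using poly_growth_plus, poly_growth_INR_mult.
    rewrite nb_mean_der_INR_mult by auto.
    rewrite (proj1 (IH (S (S r)))), (proj1 (IH (S r))), (proj2 (IH (S r))) by lia.
    simpl pred. rewrite (proj1 (IH r)) by lia. ring.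
Qed.

(** Of the three terms of [nb_mean_der_INR_mult], those of order r + 2 and r + 1 vanish; the
    coefficient of the one of order r, over N - r g, is one factor of the product in the
    overview. *)
Lemma nb_mean_der_moment_diag (c g N x y : R) (r : nat) : 0 < c -> 0 < g -> 0 < x ->
  nb_mean_der c g (S r) (wmoment N g y (S r)) x =
  INR (S r) * ((g * c + g * INR r) / (N - INR r * g)) * nb_mean_der c g r (wmoment N g y r) x.
Proof.
  intros Hc Hg Hx. assert (Hgx : 0 < g * x) by nra.
  set (u := - (N * y) + INR r * (1 + 2 * g * y)). set (v := INR r * (y * (1 + g * y))).
  assert (G1 := poly_growth_wmoment N g y r). assert (G2 := poly_growth_wmoment N g y (pred r)).
  assert (G3 : forall a j, poly_growth (fun k => a * wmoment N g y j k)).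
  { intros a j. apply (poly_growth_mult (fun _ => a));
      [apply poly_growth_const | apply poly_growth_wmoment]. }
  rewrite (nb_mean_der_ext c g Hc Hg (S r) _ (fun k => / (N - INR r * g) *
     (INR k * wmoment N g y r k + (u * wmoment N g y r k + v * wmoment N g y (pred r) k))));
    [| auto | apply poly_growth_wmoment | intros k; cbn [wmoment]; unfold u, v, Rdiv; ring].
  rewrite nb_mean_der_scal, !nb_mean_der_plus, !nb_mean_der_scal;
      auto using poly_growth_plus, poly_growth_INR_mult.
  rewrite nb_mean_der_INR_mult, (nb_mean_der_moment c g N x y (S (S r)) r),
      (nb_mean_der_moment c g N x y (S r) r),
    (nb_mean_der_moment c g N x y (S r) (pred r)) by (auto; lia).
  simpl pred. rewrite S_INR. unfold Rdiv. ring.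
Qed.

Lemma is_weight_wmoment (n : nat) (g y : R) (m k : nat) : 0 < g -> 0 < INR n -> INR m * g <= INR
    n ->
  is_weight n g k (fun t => (t - y) ^ m) (wmoment (INR n) g y m k).
Proof.
  intros Hg Hn. set (c := INR n / g).
  assert (Hc : 0 < c) by now apply Rdiv_lt_0_compat.
  assert (Hcg : c * g = INR n) by (unfold c; field; lra).
  enough (H : INR m * g <= INR n -> is_weight n g k (fun t => (t - y) ^ m) (wmoment (INR n) g y m
      k) /\
     is_weight n g k (fun t => (t - y) ^ pred m) (wmoment (INR n) g y (pred m) k)) by apply H.
  induction m as [|m IH]; intros Hm.
  { split; simpl wmoment; simpl pow; now apply is_weight_one. }
  assert (Hm0 := pos_INR m). rewrite S_INR in Hm.
  destruct IH as [IH1 IH2]; [nra|]. split; [|auto].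
  assert (Hd : 0 < INR n - INR m * g) by nra.
  (* With F = b (t - y)^m t (1 + g t), the product b G is F'. The coefficients come from k - n t =
     (k - n y) - n (t - y) and t (1 + g t) = y (1 + g y) + (1 + 2 g y)(t - y) + g (t - y)^2. For k =
     0 evaluation at 0 gives 0, since k - n t and t (1 + g t) both vanish there. *)
  set (G := fun t => (INR k - INR n * y + INR m * (1 + 2 * g * y)) * (t - y) ^ m
      + INR m * (y * (1 + g * y)) * (t - y) ^ pred m - (INR n - INR m * g) * (t - y) ^ S m).
  assert (HG : is_weight n g k G 0).
  { destruct k as [|j].
    - simpl. unfold G. simpl INR.
      destruct m as [|m']; [simpl; ring|]. simpl pred. rewrite <- !tech_pow_Rmult. ring.
    - set (F := fun t => bconst c g j * ((t - y) ^ m * (/ g * ((g * t) ^ S j * Rpower (1 + g * t)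
        (- (c + INR j + 2))) * (1 + g * t)))).
      assert (HFb : forall t, 0 <= t -> F t = b_nkg n (S j) g t * ((t - y) ^ m * (t * (1 + g *
          t)))).
      { intros t Ht. rewrite b_nkg_eq by nra. unfold F, c. simpl pow. field. lra. }
      assert (Hdiff : is_RInt_gen (fun t => b_nkg n (S j) g t * G t) (at_point 0) (Rbar_locally
          p_infty) (0 - 0)).
      { apply is_RInt_gen_primitive with (fun t => 0 <= t) F.
        - apply at_point_filter.
        - unfold at_point. lra.
        - intros; lra.
        - intros t Ht. assert (Hgt : 0 <= g * t) by nra.
          assert (D1 := is_derive_b_nkg_primitive n g j t ltac:(lra)). fold c in D1.
          assert (D2 : is_derive (fun t => (t - y) ^ m) t (INR m * (t - y) ^ pred m)).
          { auto_derive; [auto | unfold Rminus; ring]. }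
          assert (D3 : is_derive (fun t => / g * (1 + g * t)) t 1) by (auto_derive;
              [auto | field; lra]).
          assert (D4 := is_derive_scal _ _ (bconst c g j) _ (is_derive_mult _ _ _ _ _ D2
             (is_derive_mult _ _ _ _ _ D1 D3 Rmult_comm) Rmult_comm)).
          revert D4. unfold plus, mult; simpl. unfold mult; simpl. intros D4.
          apply (is_derive_ext _ F) in D4;
            [|intros u; match goal with |- ?a = ?b => change (@eq R a b) end; unfold F; simpl;
                ring].
          match type of D4 with is_derive _ _ ?L => match goal with |- is_derive _ _ ?R =>
            replace R with L; [exact D4|] end end.
          change (match j with O => 1 | S _ => INR j + 1 end) with (INR (S j)).
          rewrite b_nkg_eq by lra. fold c. unfold G. rewrite S_INR, <- Hcg.
          replace (- (c + (INR j + 1) + 2)) with (- (c + INR j + 2) + - (1)) by ring.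
          rewrite Rpower_plus, (Rpower_Ropp _ 1), Rpower_1 by lra.
          destruct m as [|m'].
          + simpl. field. lra.
          + simpl pred. rewrite <- !tech_pow_Rmult. field. lra.
        - intros t Ht. apply (continuous_mult (K := R_AbsRing)); [now apply continuous_b_nkg|].
          apply (ex_derive_continuous G). unfold G. auto_derive. auto.
        - intros P HP. apply locally_singleton in HP. unfold filtermap, at_point.
          replace (F 0) with 0; [exact HP|]. rewrite HFb by lra. ring.
        (* F carries a polynomial of degree m + 2, and one more power gives the decay 1/(1+t). The
           requirement m + 3 <= c + 2 of [b_nkg_decay] is the hypothesis on [S m]. *)
        - apply filterlim_0_dominated_inv with ((1 + g) * (1 + Rabs y) ^ m * (bconst c g j * (1 +
            / g) ^ (m + 3))).
          intros t Ht. rewrite HFb by lra. assert (Hgt : 0 < g * t) by nra.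
          assert (Hb := b_nkg_nonneg n g Hg Hc j t ltac:(lra)).
          apply -> Rle_div_r; [|lra].
          rewrite !Rabs_mult, (Rabs_pos_eq (b_nkg _ _ _ _)), (Rabs_pos_eq t),
              (Rabs_pos_eq (1 + g * t)) by lra.
          assert (H1 := b_nkg_decay n g Hg Hc j (m + 3) t ltac:(lra)).
          rewrite plus_INR in H1. simpl INR in H1. fold c in H1. specialize (H1 ltac:(nra)).
          assert (Hy := Rabs_pos y).
          assert (H2 : Rabs ((t - y) ^ m) <= (1 + Rabs y) ^ m * (1 + t) ^ m).
          { rewrite <- RPow_abs, <- Rpow_mult_distr. apply pow_incr. split; [apply Rabs_pos|].
            unfold Rminus. eapply Rle_trans; [apply Rabs_triang|].
            rewrite Rabs_Ropp, (Rabs_pos_eq t) by lra. nra. }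
          assert (H3 : t * (1 + g * t) * (1 + t) <= (1 + g) * (1 + t) ^ 3).
          { assert (t * (1 + g * t) <= (1 + g) * (1 + t) ^ 2) by nra.
            replace ((1 + g) * (1 + t) ^ 3) with ((1 + g) * (1 + t) ^ 2 * (1 + t)) by ring.
            apply Rmult_le_compat_r; lra. }
          apply Rle_trans with (b_nkg n (S j) g t * (((1 + Rabs y) ^ m * (1 + t) ^ m) * ((1 + g)
              * (1 + t) ^ 3))).
          + replace (b_nkg n (S j) g t * (Rabs ((t - y) ^ m) * (t * (1 + g * t))) * (1 + t))
              with (b_nkg n (S j) g t * (Rabs ((t - y) ^ m) * (t * (1 + g * t) * (1 + t)))) by ring.
            apply Rmult_le_compat_l; auto. apply Rmult_le_compat; auto; [apply Rabs_pos|].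
            apply Rmult_le_pos; nra.
          + replace (b_nkg n (S j) g t * ((1 + Rabs y) ^ m * (1 + t) ^ m * ((1 + g) * (1 + t) ^ 3)))
              with ((1 + g) * (1 + Rabs y) ^ m * (b_nkg n (S j) g t * (1 + t) ^ (m + 3)))
              by (rewrite pow_add; ring).
            apply Rmult_le_compat_l; auto. apply Rmult_le_pos; [lra | apply pow_le; lra]. }
      rewrite Rminus_0_r in Hdiff. exact Hdiff. }
  assert (H := is_weight_scal n g k (/ (INR n - INR m * g)) _ _
    (is_weight_plus n g k _ _ _ _ (is_weight_plus n g k _ _ _ _
      (is_weight_scal n g k (INR k - INR n * y + INR m * (1 + 2 * g * y)) _ _ IH1)
      (is_weight_scal n g k (INR m * (y * (1 + g * y))) _ _ IH2))
      (is_weight_scal n g k (-1) _ _ HG))).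
  apply (is_weight_ext n g k _ (fun t => (t - y) ^ S m)) in H.
  - match type of H with is_weight _ _ _ _ ?L => match goal with |- is_weight _ _ _ _ ?R =>
            replace R with L; [exact H|] end end.
    cbn [wmoment]. field. lra.
  - intros t _. unfold G. field. lra.
Qed.

(** The centre is off x by e/n only, so k - n y differs from k - n x by the constant e. Dividing by
    N - m g, of size q^2, turns the factor k - n y + O(1), of size q s with s = 1 + |k - n x|/q,
    into s/q: each order gains 1/q. *)
Lemma wmoment_bound (g x e : R) (m : nat) : 0 < g -> 0 < x ->
  exists C q0, 0 <= C /\ 1 <= q0 /\ forall q k, q0 <= q ->
    Rabs (q ^ m * wmoment (q ^ 2) g (x + e / q ^ 2) m k) <= C * (1 + Rabs (INR k - q ^ 2 * x) /
        q) ^ m.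
Proof.
  intros Hg Hx.
  set (P m := exists C q0, 0 <= C /\ 1 <= q0 /\ forall q k, q0 <= q ->
    Rabs (q ^ m * wmoment (q ^ 2) g (x + e / q ^ 2) m k) <= C * (1 + Rabs (INR k - q ^ 2 * x) /
        q) ^ m).
  enough (H : P m /\ P (pred m)) by apply H.
  induction m as [|m [[C1 [q1 [HC1 [Hq1 IH1]]]] [C2 [q2 [HC2 [Hq2 IH2]]]]]].
  { assert (B : P 0%nat).
    { exists 1, 1. repeat split; try lra. intros q k _. simpl. rewrite Rmult_1_l, Rabs_R1. lra. }
    now split. }
  split; [|now exists C1, q1].
  set (Y := x + Rabs e). assert (He := Rabs_pos e). assert (HY : 0 < Y) by (unfold Y; lra).
  assert (Hm := pos_INR m).
  set (a := INR m * (1 + 2 * g * Y)). set (b := INR m * (Y * (1 + g * Y))).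
  assert (HgY : 0 < g * Y) by nra.
  assert (Ha : 0 <= a) by (apply Rmult_le_pos; lra).
  assert (Hb : 0 <= b) by (apply Rmult_le_pos; nra).
  (* For q >= 1 + 2 m g, q^2 - m g >= q^2/2; this is the origin of the factor 2. *)
  exists (2 * ((1 + Rabs e + a) * C1 + b * C2)), (Rmax (Rmax q1 q2) (1 + 2 * INR m * g)).
  split; [nra|]. split.
  { eapply Rle_trans; [apply Hq1|]. eapply Rle_trans; [apply Rmax_l | apply Rmax_l]. }
  intros q k Hq.
  assert (Hqa : q1 <= q) by (eapply Rle_trans; [|apply Hq]; eapply Rle_trans;
      [apply Rmax_l | apply Rmax_l]).
  assert (Hqb : q2 <= q) by (eapply Rle_trans; [|apply Hq]; eapply Rle_trans;
      [apply Rmax_r | apply Rmax_l]).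
  assert (Hqc : 1 + 2 * INR m * g <= q) by (eapply Rle_trans; [apply Rmax_r | apply Hq]).
  specialize (IH1 q k Hqa). specialize (IH2 q k Hqb).
  set (u := INR k - q ^ 2 * x) in *. set (y := x + e / q ^ 2) in *.
  set (s := 1 + Rabs u / q) in *. assert (Hu := Rabs_pos u).
  assert (Hqi : 0 < / q <= 1) by (split; [apply Rinv_0_lt_compat; lra | rewrite <- Rinv_1;
      apply Rinv_le_contravar; lra]).
  assert (Hs : 1 <= s) by (unfold s, Rdiv; nra).
  assert (Hmg : 0 <= INR m * g) by nra.
  assert (Hden : q ^ 2 / 2 <= q ^ 2 - INR m * g) by nra.
  assert (Hq20 : 1 <= q ^ 2) by nra.
  assert (Hy : Rabs y <= Y).
  { unfold y, Y. eapply Rle_trans; [apply Rabs_triang|]. rewrite (Rabs_pos_eq x) by lra.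
    apply Rplus_le_compat_l. unfold Rdiv. rewrite Rabs_mult, Rabs_inv, (Rabs_pos_eq (q ^ 2)) by lra.
    rewrite <- (Rmult_1_r (Rabs e)) at 2. apply Rmult_le_compat_l; [lra|].
    rewrite <- Rinv_1. apply Rinv_le_contravar; lra. }
  cbn [wmoment]. set (v1 := wmoment (q ^ 2) g y m k) in *.
  set (v2 := wmoment (q ^ 2) g y (pred m) k) in *.
  replace (INR k - q ^ 2 * y) with (u - e) by (unfold u, y; field; lra).
  assert (Hsm : 0 <= s ^ m) by (apply pow_le; lra).
  assert (N1 : Rabs ((u - e + INR m * (1 + 2 * g * y)) * (q ^ m * v1)) <= q * ((1 + Rabs e + a) *
      C1 * s ^ S m)).
  { rewrite Rabs_mult.
    assert (Rabs (u - e + INR m * (1 + 2 * g * y)) <= q * (1 + Rabs e + a) * s).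
    { assert (Rabs (INR m * (1 + 2 * g * y)) <= a).
      { unfold a. rewrite Rabs_mult, (Rabs_pos_eq (INR m)) by auto. apply Rmult_le_compat_l; auto.
        eapply Rle_trans; [apply Rabs_triang|]. rewrite Rabs_R1, Rabs_mult,
            (Rabs_pos_eq (2 * g)) by lra.
        apply Rplus_le_compat_l, Rmult_le_compat_l; lra. }
      assert (T1 := Rabs_triang (u - e) (INR m * (1 + 2 * g * y))).
      assert (T2 := Rabs_triang u (- e)). rewrite Rabs_Ropp in T2. unfold Rminus in *.
      replace (q * (1 + Rabs e + a) * s) with ((1 + Rabs e + a) * (q + Rabs u)) by (unfold s;
          field; lra).
      nra. }
    replace (q * ((1 + Rabs e + a) * C1 * s ^ S m)) with ((q * (1 + Rabs e + a) * s) * (C1 * s ^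
        m)) by (simpl; ring).
    apply Rmult_le_compat; auto; apply Rabs_pos. }
  assert (N2 : Rabs (INR m * (y * (1 + g * y)) * (q ^ m * v2)) <= q * (b * C2 * s ^ S m)).
  { destruct m as [|m']; [simpl INR; rewrite !Rmult_0_l, Rabs_R0; unfold b; simpl INR; lra|].
    simpl pred in *. rewrite <- (tech_pow_Rmult q m').
    replace (INR (S m') * (y * (1 + g * y)) * (q * q ^ m' * v2))
      with (q * (INR (S m') * (y * (1 + g * y)) * (q ^ m' * v2))) by ring.
    rewrite Rabs_mult, (Rabs_pos_eq q) by lra. apply Rmult_le_compat_l; [lra|].
    rewrite Rabs_mult, Rmult_assoc.
    assert (Rabs (INR (S m') * (y * (1 + g * y))) <= b).
    { unfold b. rewrite !Rabs_mult, (Rabs_pos_eq (INR _)) by auto. apply Rmult_le_compat_l; auto.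
      apply Rmult_le_compat; auto; try apply Rabs_pos.
      eapply Rle_trans; [apply Rabs_triang|]. rewrite Rabs_R1, Rabs_mult, (Rabs_pos_eq g) by lra.
      apply Rplus_le_compat_l, Rmult_le_compat_l; lra. }
    apply Rmult_le_compat; auto; try apply Rabs_pos.
    eapply Rle_trans; [apply IH2|]. apply Rmult_le_compat_l; auto. apply Rle_pow; [auto | lia]. }
  replace (q ^ S m * (((u - e + INR m * (1 + 2 * g * y)) * v1 + INR m * (y * (1 + g * y)) * v2) /
      (q ^ 2 - INR m * g)))
    with (q * / (q ^ 2 - INR m * g) * ((u - e + INR m * (1 + 2 * g * y)) * (q ^ m * v1) + INR m *
        (y * (1 + g * y)) * (q ^ m * v2)))
    by (simpl; field; simpl in *; lra).
  assert (Hi : 0 < / (q ^ 2 - INR m * g) <= 2 * / q ^ 2).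
  { split; [apply Rinv_0_lt_compat; lra|].
    replace (2 * / q ^ 2) with (/ (q ^ 2 / 2)) by (field; lra). apply Rinv_le_contravar; lra. }
  rewrite Rabs_mult, (Rabs_pos_eq (q * _)) by (apply Rmult_le_pos; lra).
  set (Z := (1 + Rabs e + a) * C1 * s ^ S m + b * C2 * s ^ S m).
  assert (HZ : 0 <= Z).
  { assert (0 <= s ^ S m) by (apply pow_le; lra). unfold Z.
    apply Rplus_le_le_0_compat; apply Rmult_le_pos; auto; apply Rmult_le_pos; lra. }
  apply Rle_trans with (q * (2 * / q ^ 2) * (q * Z)).
  - apply Rmult_le_compat; [apply Rmult_le_pos; lra | apply Rabs_pos | apply Rmult_le_compat_l;
      lra |].
    eapply Rle_trans; [apply Rabs_triang|]. unfold Z. lra.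
  - right. unfold Z. field. lra.
Qed.

(** * Taylor expansion and the limit *)

Lemma is_derive_poly_primitive (c : nat -> R) (c0 x t : R) (m : nat) :
  is_derive
    (fun t => sum_f_R0 (fun i => match i with O => c0 | S j => c j / INR (S j) end * (t - x) ^ i) (S m)) t
    (sum_f_R0 (fun i => c i * (t - x) ^ i) m).
Proof.
  induction m as [|m IH].
  - simpl. auto_derive; [auto | field].
  - rewrite (tech5 _ m).
    apply (is_derive_ext (fun t =>
        sum_f_R0 (fun i => match i with O => c0 | S j => c j / INR (S j) end * (t - x) ^ i) (S m)
        + c (S m) / INR (S (S m)) * (t - x) ^ S (S m))); [intros u; now rewrite (tech5 _ (S m))|].
    apply (is_derive_plus (K := R_AbsRing) (V := R_NormedModule)); auto.
    assert (Hm := pos_INR (S m)). rewrite (S_INR (S m)).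
    auto_derive; [auto|]. cbn [pred].
    change (match m with O => 1 | S _ => INR m + 1 end) with (INR (S m)).
    unfold Rminus. rewrite <- tech_pow_Rmult. field. lra.
Qed.

(** Induction through f': the mean value theorem writes the remainder of f at t as (t - x) times
    that of f' at an intermediate point. Only the top coefficient is specified, as the r-th
    derivative will kill the contribution of the others. *)
Lemma taylor_peano (r : nat) (f : R -> R) (x l : R) : rth_derivative_at f (S r) x l ->
  exists co : nat -> R, co (S r) = l / INR (fact (S r)) /\
    forall eps, 0 < eps -> exists delta, 0 < delta /\ forall t, Rabs (t - x) < delta ->
      Rabs (f t - sum_f_R0 (fun i => co i * (t - x) ^ i) (S r)) <= eps * Rabs (t - x) ^ S r.
Proof.
  revert f. induction r as [|r IH]; intros f [G [d [HG0 [HG1 HG2]]]].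
  - exists (fun i => match i with O => f x | S _ => l end). split; [simpl; field|].
    rewrite HG0 in HG2. apply is_derive_Reals in HG2.
    intros eps Heps. destruct (HG2 eps Heps) as [delta Hd].
    exists delta. split; [apply cond_pos|]. intros t Ht.
    destruct (Req_dec t x) as [->|Hne].
    + simpl. rewrite Rminus_eq_0, Rabs_R0.
      replace (f x - (f x * 1 + l * (0 * 1))) with 0 by ring. rewrite Rabs_R0. lra.
    + assert (Hh : t - x <> 0) by lra. specialize (Hd (t - x) Hh Ht).
      replace (x + (t - x)) with t in Hd by ring.
      simpl. rewrite !Rmult_1_r.
      replace (f t - (f x + l * (t - x))) with (((f t - f x) / (t - x) - l) * (t - x)) by (field;
          lra).
      rewrite Rabs_mult. apply Rmult_le_compat_r; [apply Rabs_pos | lra].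
  - destruct (IH (G 1%nat)) as [co [Hco1 Hco2]].
    { exists (fun j => G (S j)), d. split; [auto|]. split; [|exact HG2].
      intros j y Hj Hy. apply HG1; [lia | auto]. }
    exists (fun i => match i with O => f x | S j => co j / INR (S j) end). split.
    { rewrite Hco1, (fact_simpl (S r)), mult_INR.
      assert (H1 := INR_fact_lt_0 (S r)). assert (H2 := lt_0_INR (S (S r)) ltac:(lia)). field.
      lra. }
    intros eps Heps. destruct (Hco2 eps Heps) as [delta [Hdelta Hd]].
    exists (Rmin delta d). split; [apply Rmin_case; [auto | apply cond_pos]|].
    intros t Ht.
    assert (Ht1 : Rabs (t - x) < delta) by (eapply Rlt_le_trans; [apply Ht | apply Rmin_l]).
    assert (Ht2 : Rabs (t - x) < d) by (eapply Rlt_le_trans; [apply Ht | apply Rmin_r]).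
    set (T := fun t => sum_f_R0 (fun i => match i with O => f x | S j => co j / INR (S j) end *
        (t - x) ^ i) (S (S r))).
    set (T' := fun t => sum_f_R0 (fun i => co i * (t - x) ^ i) (S r)).
    assert (Hbetween : forall s, Rmin x t <= s <= Rmax x t -> Rabs (s - x) <= Rabs (t - x)).
    { intros s. unfold Rmin, Rmax, Rabs. destruct (Rle_dec x t), (Rcase_abs (s - x)),
        (Rcase_abs (t - x)); lra. }
    assert (Hder : forall s, Rmin x t <= s <= Rmax x t -> is_derive (fun t => f t - T t) s (G
        1%nat s - T' s)).
    { intros s Hs. apply (is_derive_minus (K := R_AbsRing) (V := R_NormedModule) f T).
      - rewrite <- HG0. apply HG1; [lia|]. eapply Rle_lt_trans; eauto.
      - apply is_derive_poly_primitive. }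
    destruct (MVT_gen (fun t => f t - T t) x t (fun s => G 1%nat s - T' s)) as [s [Hs Heq]].
    + intros s Hs. apply Hder. lra.
    + intros s Hs. apply continuity_pt_filterlim, (ex_derive_continuous (fun t => f t - T t)).
      eexists. now apply Hder.
    + assert (HTx : T x = f x).
      { unfold T. rewrite decomp_sum by lia. simpl pred.
        rewrite (sum_eq _ (fun _ => 0)); [rewrite sum_cte; simpl; ring|].
        intros i _. rewrite Rminus_eq_0. simpl. ring. }
      rewrite HTx in Heq. fold (T t).
      replace (f t - T t) with ((G 1%nat s - T' s) * (t - x)) by lra.
      rewrite Rabs_mult, <- (tech_pow_Rmult _ (S r)).
      assert (Hs' := Hbetween s Hs).
      assert (B := Hd s ltac:(lra)). fold (T' s) in B.
      assert (P : Rabs (s - x) ^ S r <= Rabs (t - x) ^ S r).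
      { apply pow_incr. split; [apply Rabs_pos | auto]. }
      replace (eps * (Rabs (t - x) * Rabs (t - x) ^ S r)) with (eps * Rabs (t - x) ^ S r * Rabs
          (t - x)) by ring.
      apply Rmult_le_compat_r; [apply Rabs_pos|].
      eapply Rle_trans; [apply B|]. apply Rmult_le_compat_l; lra.
Qed.

Lemma pow_le_pow_far (delta z : R) (i N : nat) : 0 < delta -> delta <= z -> (i <= N)%nat ->
  z ^ i <= (/ delta) ^ (N - i) * z ^ N.
Proof.
  intros Hd Hz Hi. replace (z ^ N) with (z ^ i * z ^ (N - i)) by (rewrite <- pow_add; f_equal; lia).
  replace ((/ delta) ^ (N - i) * (z ^ i * z ^ (N - i))) with (z ^ i * (/ delta * z) ^ (N - i))
    by (rewrite Rpow_mult_distr; ring).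
  rewrite <- (Rmult_1_r (z ^ i)) at 1. apply Rmult_le_compat_l; [apply pow_le; lra|].
  apply pow_R1_Rle. apply Rmult_le_reg_l with delta; auto.
  rewrite <- Rmult_assoc, Rinv_r by lra. lra.
Qed.

Lemma poly_le_pow_far (co : nat -> R) (delta : R) (r N : nat) : 0 < delta -> (r <= N)%nat ->
  exists D, 0 <= D /\ forall z, delta <= Rabs z ->
    Rabs (sum_f_R0 (fun i => co i * z ^ i) r) <= D * Rabs z ^ N.
Proof.
  intros Hd.
  assert (S1 : forall i, (i <= N)%nat -> forall z, delta <= Rabs z ->
            Rabs (co i * z ^ i) <= Rabs (co i) * (/ delta) ^ (N - i) * Rabs z ^ N).
  { intros i Hi z Hz. rewrite Rabs_mult, <- RPow_abs, Rmult_assoc.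
    apply Rmult_le_compat_l; [apply Rabs_pos | now apply pow_le_pow_far]. }
  assert (S2 : forall i, 0 <= Rabs (co i) * (/ delta) ^ (N - i)).
  { intros i. apply Rmult_le_pos; [apply Rabs_pos | apply pow_le; left;
      now apply Rinv_0_lt_compat]. }
  induction r as [|r IH]; intros Hr.
  - exists (Rabs (co 0%nat) * (/ delta) ^ (N - 0)). split; auto. intros z Hz. now apply (S1 0%nat).
  - destruct IH as [D [HD1 HD2]]; [lia|].
    exists (D + Rabs (co (S r)) * (/ delta) ^ (N - S r)).
    split; [specialize (S2 (S r)); lra|]. intros z Hz. rewrite tech5.
    eapply Rle_trans; [apply Rabs_triang|]. rewrite Rmult_plus_distr_r.
    apply Rplus_le_compat; auto.
Qed.

Lemma C_mu_growth (mu : R) (f : R -> R) : 0 < mu -> C_mu mu f ->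
  exists (B : R) (m : nat), 0 <= B /\ forall t, 0 <= t -> Rabs (f t) <= B * (1 + t) ^ m.
Proof.
  intros Hmu [_ [M [HM HB]]]. destruct (INR_unbounded mu) as [m Hm].
  exists (M + Rabs (f 0)), m. assert (H0 := Rabs_pos (f 0)). split; [lra|]. intros t Ht.
  assert (H1 : 1 <= (1 + t) ^ m) by (apply pow_R1_Rle; lra).
  destruct Ht as [Ht|<-]; [|nra].
  assert (H2 : Rpower t mu <= (1 + t) ^ m).
  { rewrite <- Rpower_pow by lra. apply Rle_trans with (Rpower (1 + t) mu).
    - apply Rle_Rpower_l; lra.
    - apply Rle_Rpower; lra. }
  specialize (HB t Ht). nra.
Qed.

Lemma growth_far (h : R -> R) (B x delta : R) (m N : nat) :
  0 < x -> 0 < delta -> 0 <= B -> (m <= N)%nat ->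
  (forall t, 0 <= t -> Rabs (h t) <= B * (1 + t) ^ m) ->
  exists D, 0 <= D /\ forall t, 0 <= t -> delta <= Rabs (t - x) -> Rabs (h t) <= D * Rabs (t - x)
      ^ N.
Proof.
  intros Hx Hd HB HmN Hh.
  assert (Hi : 0 < / delta) by now apply Rinv_0_lt_compat.
  (* 1 + t <= (1 + x) + |t - x|, and 1 + x <= ((1 + x)/delta) |t - x| when |t - x| >= delta. *)
  set (K := (1 + x) * / delta + 1). assert (HK : 0 < K) by (unfold K; nra).
  assert (HKm : 0 <= K ^ m) by (apply pow_le; lra).
  exists (B * (K ^ m * (/ delta) ^ (N - m))).
  split; [apply Rmult_le_pos; auto; apply Rmult_le_pos; auto; apply pow_le; lra|].
  intros t Ht Hfar. eapply Rle_trans; [apply Hh; auto|]. rewrite !Rmult_assoc.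
  apply Rmult_le_compat_l; auto.
  apply Rle_trans with (K ^ m * Rabs (t - x) ^ m).
  - rewrite <- Rpow_mult_distr. apply pow_incr. split; [lra|].
    assert (Hfar1 : 1 <= / delta * Rabs (t - x)).
    { apply Rmult_le_reg_l with delta; auto. rewrite <- Rmult_assoc, Rinv_r by lra. lra. }
    assert (H := Rle_abs (t - x)). unfold K.
    replace (((1 + x) * / delta + 1) * Rabs (t - x))
      with ((1 + x) * (/ delta * Rabs (t - x)) + Rabs (t - x)) by ring. nra.
  - apply Rmult_le_compat_l; auto. now apply pow_le_pow_far.
Qed.

(** Near x this is the Peano estimate; away from x both f and the polynomial are dominated by (t -
    x)^(2p). The coefficients precede eps: only C may depend on it. *)
Lemma taylor_remainder_bound (r m p : nat) (f : R -> R) (x l B : R) :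
  0 < x -> 0 <= B -> (forall t, 0 <= t -> Rabs (f t) <= B * (1 + t) ^ m) ->
  (m <= 2 * p)%nat -> (S r <= 2 * p)%nat -> rth_derivative_at f (S r) x l ->
  exists co : nat -> R, co (S r) = l / INR (fact (S r)) /\
    forall eps, 0 < eps -> exists C, 0 <= C /\ forall t, 0 <= t ->
      Rabs (f t - sum_f_R0 (fun i => co i * (t - x) ^ i) (S r))
        <= eps * Rabs (t - x) ^ S r + C * (t - x) ^ (2 * p).
Proof.
  intros Hx HB Hf Hm Hr Hder. destruct (taylor_peano r f x l Hder) as [co [Hco HT]].
  exists co. split; auto. intros eps Heps. destruct (HT eps Heps) as [delta [Hd Hnear]].
  destruct (growth_far f B x delta m (2 * p) Hx Hd HB Hm Hf) as [D1 [HD1 H1]].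
  destruct (poly_le_pow_far co delta (S r) (2 * p) Hd Hr) as [D2 [HD2 H2]].
  exists (D1 + D2). split; [lra|]. intros t Ht.
  replace ((t - x) ^ (2 * p)) with (Rabs (t - x) ^ (2 * p))
    by (rewrite !pow_mult, pow2_abs; reflexivity).
  assert (P1 : 0 <= Rabs (t - x) ^ (2 * p)) by (apply pow_le, Rabs_pos).
  assert (P2 : 0 <= Rabs (t - x) ^ S r) by (apply pow_le, Rabs_pos).
  destruct (Rlt_le_dec (Rabs (t - x)) delta) as [Hlt|Hge].
  - specialize (Hnear t Hlt). assert (0 <= (D1 + D2) * Rabs (t - x) ^ (2 * p))
      by (apply Rmult_le_pos; lra). lra.
  - specialize (H1 t Ht Hge). specialize (H2 (t - x) Hge).
    unfold Rminus at 1. eapply Rle_trans; [apply Rabs_triang|]. rewrite Rabs_Ropp.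
    assert (0 <= eps * Rabs (t - x) ^ S r) by (apply Rmult_le_pos; lra). lra.
Qed.

(** Applied to z = q (t - y), it replaces an absolute moment of order r by the moment of order 2r,
    which [wmoment] computes. *)
Lemma pow_Rabs_le_sqr (z : R) (r : nat) : Rabs z ^ r <= 1 + z ^ (2 * r).
Proof.
  rewrite Nat.mul_comm, pow_mult, RPow_abs, <- (pow2_abs (z ^ r)).
  assert (H := Rabs_pos (z ^ r)). nra.
Qed.

(* The r-th derivative costs a factor q^r, q = sqrt n; the first term of the bound on h gains q^-r
   and comes with the arbitrary factor eps, the second one gains q^-2p, which is at most q^-(r+1). *)
Lemma remainder_der_bound (g a b x : R) (r p : nat) (h : R -> R) :
  0 < g -> 0 <= a -> 0 <= b -> 0 < x -> (r <= p)%nat -> (S r <= 2 * p)%nat ->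
  (forall eps, 0 < eps -> exists C, 0 <= C /\ forall t, 0 <= t ->
      Rabs (h t) <= eps * Rabs (t - x) ^ r + C * (t - x) ^ (2 * p)) ->
  forall eps, 0 < eps -> exists N, forall n, (N <= n)%nat -> forall rho,
    (forall k, is_weight n g k (fun t => h ((INR n * t + a) / (INR n + b))) (rho k)) ->
    Rabs (nb_mean_der (INR n / g) g r rho x) <= eps.
Proof.
  intros Hg Ha Hb Hx Hrp Hr2 Hh eps Heps.
  destruct (nb_score_bound g x r Hg Hx) as [CQ [HCQ HQ]].
  set (e := b * x - a).
  destruct (wmoment_bound g x e (2 * r) Hg Hx) as [C1 [q1 [HC1 [Hq1 HV1]]]].
  destruct (wmoment_bound g x e (2 * p) Hg Hx) as [C2 [q2 [HC2 [Hq2 HV2]]]].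
  destruct (standardized_moment_bound g x (r + 2 * p) Hg Hx) as [CE [q3 [HCE [Hq3 HE]]]].
  set (eps1 := eps / (2 * (CQ + 1) * CE * (1 + C1))).
  (* [eps1] and [q4] are tuned so that each half of the final bound K CE is at most eps/2; CQ + 1
     keeps the divisor positive when CQ = 0. *)
  assert (Hp1 : 0 < 2 * (CQ + 1) * CE * (1 + C1)) by (repeat apply Rmult_lt_0_compat; lra).
  assert (Heps1 : 0 < eps1) by now apply Rdiv_lt_0_compat.
  destruct (Hh eps1 Heps1) as [C [HC HhC]].
  set (q4 := (2 * (CQ + 1) * CE * (C * C2)) / eps).
  set (qmax := Rmax (Rmax q1 q2) (Rmax q3 q4)).
  (* The first summand forces sqrt n >= qmax, the second makes the moments of order 2p available. *)
  destruct (INR_unbounded (qmax ^ 2 + INR (2 * p) * g)) as [N HN].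
  exists N. intros n Hn rho Hrho.
  assert (HNn : qmax ^ 2 + INR (2 * p) * g <= INR n) by (apply le_INR in Hn; lra).
  assert (Hm1 : q1 <= qmax) by (eapply Rle_trans; [apply Rmax_l | apply Rmax_l]).
  assert (Hm2 : q2 <= qmax) by (eapply Rle_trans; [apply Rmax_r | apply Rmax_l]).
  assert (Hm3 : q3 <= qmax) by (eapply Rle_trans; [apply Rmax_l | apply Rmax_r]).
  assert (Hm4 : q4 <= qmax) by (eapply Rle_trans; [apply Rmax_r | apply Rmax_r]).
  clearbody qmax.
  assert (Hpg : 0 <= INR (2 * p) * g) by (apply Rmult_le_pos; [apply pos_INR | lra]).
  set (q := sqrt (INR n)).
  assert (Hqn : q ^ 2 = INR n) by (apply pow2_sqrt, pos_INR).
  assert (Hq : qmax <= q).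
  { unfold q. rewrite <- (sqrt_pow2 qmax) by lra. apply sqrt_le_1; nra. }
  assert (Hn0 : 1 <= INR n) by nra.
  assert (Hc : 0 < INR n / g) by (apply Rdiv_lt_0_compat; lra).
  set (y := x + e / INR n). set (ka := INR n / (INR n + b)).
  assert (Hka : 0 < ka <= 1).
  { unfold ka. split; [apply Rdiv_lt_0_compat; lra | apply <- Rle_div_l; lra]. }
  assert (Htau : forall t, (INR n * t + a) / (INR n + b) - x = ka * (t - y)).
  { intros t. unfold ka, y, e. field. lra. }
  assert (Hqr : 0 < q ^ r) by (apply pow_lt; lra).
  set (s := fun k => 1 + Rabs (INR k - INR n * x) / q).
  assert (Hs : forall k, 1 <= s k).
  { intros k. unfold s. assert (0 <= Rabs (INR k - INR n * x) / q); [|lra].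
    apply Rmult_le_pos; [apply Rabs_pos | left; apply Rinv_0_lt_compat; lra]. }
  set (v1 := wmoment (INR n) g y (2 * r)). set (v2 := wmoment (INR n) g y (2 * p)).
  assert (Hsmall : INR (2 * r) <= INR (2 * p)) by (apply le_INR; lia).
  assert (HW1 : forall k, is_weight n g k (fun t => (t - y) ^ (2 * r)) (v1 k)).
  { intros k. apply is_weight_wmoment; nra. }
  assert (HW2 : forall k, is_weight n g k (fun t => (t - y) ^ (2 * p)) (v2 k)).
  { intros k. apply is_weight_wmoment; nra. }
  (* The weights of the pointwise majorant of |h|. By positivity of the functionals they bound |rho
     k|. *)
  set (bnd := fun k => eps1 * / q ^ r * (1 + q ^ (2 * r) * v1 k) + C * v2 k).
  assert (Hbw : forall k, is_weight n g k (fun t => eps1 * / q ^ r * (1 + q ^ (2 * r) * (t - y) ^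
      (2 * r)) + C * (t - y) ^ (2 * p)) (bnd k)).
  { intros k. unfold bnd.
    apply (is_weight_plus n g k (fun t => eps1 * / q ^ r * (1 + q ^ (2 * r) * (t - y) ^ (2 * r)))
        (fun t => C * (t - y) ^ (2 * p)));
      [|now apply is_weight_scal].
    apply is_weight_scal.
    apply (is_weight_plus n g k (fun _ => 1) (fun t => q ^ (2 * r) * (t - y) ^ (2 * r)));
      [now apply is_weight_one | now apply is_weight_scal]. }
  assert (Hpt : forall t, 0 <= t -> Rabs (h ((INR n * t + a) / (INR n + b)))
      <= eps1 * / q ^ r * (1 + q ^ (2 * r) * (t - y) ^ (2 * r)) + C * (t - y) ^ (2 * p)).
  { intros t Ht. eapply Rle_trans.
    - apply HhC. apply Rmult_le_pos; [nra | left; apply Rinv_0_lt_compat; lra].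
    - rewrite Htau. apply Rplus_le_compat.
      + rewrite Rmult_assoc. apply Rmult_le_compat_l; [lra|].
        apply Rmult_le_reg_l with (q ^ r); auto. rewrite <- Rmult_assoc, Rinv_r, Rmult_1_l by lra.
        rewrite <- !Rpow_mult_distr.
        eapply Rle_trans; [|apply pow_Rabs_le_sqr]. apply pow_incr.
        rewrite !Rabs_mult, (Rabs_pos_eq ka), (Rabs_pos_eq q) by lra.
        assert (H := Rabs_pos (t - y)). split; [apply Rmult_le_pos; [lra | apply Rmult_le_pos;
            lra]|].
        apply Rmult_le_compat_l; [lra|]. nra.
      + apply Rmult_le_compat_l; [lra|]. rewrite Rpow_mult_distr.
        rewrite <- (Rmult_1_l ((t - y) ^ (2 * p))) at 2.
        apply Rmult_le_compat_r; [rewrite pow_mult; apply pow_le, pow2_ge_0|].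
        rewrite <- (pow1 (2 * p)). apply pow_incr. lra. }
  assert (Hrb : forall k, Rabs (rho k) <= bnd k).
  { intros k. apply Rabs_le. split.
    - assert (H := is_weight_scal n g k (-1) _ _ (Hrho k)).
      assert (H1 : -1 * rho k <= bnd k); [|lra].
      refine (is_weight_le n g Hg Hc k _ _ _ _ _ H (Hbw k)).
      intros t Ht. specialize (Hpt t Ht). apply Rabs_le_between in Hpt. lra.
    - refine (is_weight_le n g Hg Hc k _ _ _ _ _ (Hrho k) (Hbw k)).
      intros t Ht. specialize (Hpt t Ht). apply Rabs_le_between in Hpt. lra. }
  assert (Hrg : poly_growth rho).
  { apply poly_growth_le with bnd; [intros k; eapply Rle_trans; [apply Hrb | apply Rle_abs]|].
    unfold bnd. apply (poly_growth_plus (fun k => _ * (1 + _ * v1 k)) (fun k => C * v2 k)).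
    - apply (poly_growth_mult (fun _ => _)); [apply poly_growth_const|].
      apply (poly_growth_plus (fun _ => 1)); [apply poly_growth_const|].
      apply (poly_growth_mult (fun _ => _)); [apply poly_growth_const | apply poly_growth_wmoment].
    - apply (poly_growth_mult (fun _ => _)); [apply poly_growth_const | apply
        poly_growth_wmoment]. }
  set (K := (CQ + 1) * (eps1 * (1 + C1) + C * C2 * / q)).
  assert (Hqi : 0 < / q) by (apply Rinv_0_lt_compat; lra).
  assert (HK0 : 0 <= K).
  { unfold K. apply Rmult_le_pos; [lra|]. apply Rplus_le_le_0_compat; apply Rmult_le_pos; try lra.
    apply Rmult_le_pos; lra. }
  assert (Hterm : forall k, Rabs (nb_score (INR n / g) g x r k * rho k) <= K * s k ^ (r + 2 * p)).
  { intros k. specialize (Hs k). rewrite Rabs_mult.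
    assert (T1 : Rabs (nb_score (INR n / g) g x r k) <= (CQ + 1) * (q ^ r * s k ^ r)).
    { specialize (HQ q k ltac:(lra)). rewrite Hqn in HQ. fold (s k) in HQ.
      rewrite Rpow_mult_distr in HQ. eapply Rle_trans; [apply HQ|].
      apply Rmult_le_compat_r; [|lra]. apply Rmult_le_pos; [lra | apply pow_le; lra]. }
    assert (T2 : q ^ (2 * r) * v1 k <= C1 * s k ^ (2 * p)).
    { specialize (HV1 q k ltac:(lra)). rewrite Hqn in HV1. fold y v1 (s k) in HV1.
      eapply Rle_trans; [apply Rle_abs|]. eapply Rle_trans; [apply HV1|].
      apply Rmult_le_compat_l; auto. apply Rle_pow; [auto | lia]. }
    assert (T3 : q ^ (2 * p) * v2 k <= C2 * s k ^ (2 * p)).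
    { specialize (HV2 q k ltac:(lra)). rewrite Hqn in HV2. fold y v2 (s k) in HV2.
      eapply Rle_trans; [apply Rle_abs | apply HV2]. }
    assert (T4 : 1 <= s k ^ (2 * p)) by (now apply pow_R1_Rle).
    assert (T5 : q ^ r * rho k <= (eps1 * (1 + C1) + C * C2 * / q) * s k ^ (2 * p) /\
                 q ^ r * - rho k <= (eps1 * (1 + C1) + C * C2 * / q) * s k ^ (2 * p)).
    { assert (T6 : q ^ r * bnd k <= (eps1 * (1 + C1) + C * C2 * / q) * s k ^ (2 * p)).
      { unfold bnd. rewrite Rmult_plus_distr_l, Rmult_plus_distr_r. apply Rplus_le_compat.
        - replace (q ^ r * (eps1 * / q ^ r * (1 + q ^ (2 * r) * v1 k)))
            with (eps1 * (1 + q ^ (2 * r) * v1 k)) by (field; lra).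
          rewrite Rmult_assoc. apply Rmult_le_compat_l; lra.
        - replace (q ^ r * (C * v2 k)) with (C * (q ^ r * / q ^ (2 * p) * (q ^ (2 * p) * v2 k)))
            by (field; apply pow_nonzero; lra).
          replace (C * C2 * / q * s k ^ (2 * p)) with (C * (/ q * (C2 * s k ^ (2 * p)))) by ring.
          apply Rmult_le_compat_l; auto.
          assert (T7 : 0 <= q ^ r * / q ^ (2 * p) <= / q).
          { assert (0 < q ^ (2 * p)) by (apply pow_lt; lra).
            split; [apply Rmult_le_pos; [lra | left; now apply Rinv_0_lt_compat]|].
            apply <- Rle_div_l; auto. apply Rmult_le_reg_l with q; [lra|].
            rewrite <- Rmult_assoc, Rinv_r, Rmult_1_l, tech_pow_Rmult by lra.
            apply Rle_pow; [lra | lia]. }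
          apply Rle_trans with (q ^ r * / q ^ (2 * p) * (C2 * s k ^ (2 * p))).
          + apply Rmult_le_compat_l; lra.
          + apply Rmult_le_compat_r; [apply Rmult_le_pos; lra | lra]. }
      specialize (Hrb k). apply Rabs_le_between in Hrb.
      split; (eapply Rle_trans; [|apply T6]); apply Rmult_le_compat_l; lra. }
    assert (T8 : q ^ r * Rabs (rho k) <= (eps1 * (1 + C1) + C * C2 * / q) * s k ^ (2 * p)).
    { unfold Rabs. destruct (Rcase_abs (rho k)); apply T5. }
    apply Rle_trans with ((CQ + 1) * (q ^ r * s k ^ r) * Rabs (rho k)).
    - apply Rmult_le_compat_r; [apply Rabs_pos | auto].
    - rewrite pow_add. unfold K.
      replace ((CQ + 1) * (q ^ r * s k ^ r) * Rabs (rho k))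
        with ((CQ + 1) * s k ^ r * (q ^ r * Rabs (rho k))) by ring.
      replace ((CQ + 1) * (eps1 * (1 + C1) + C * C2 * / q) * (s k ^ r * s k ^ (2 * p)))
        with ((CQ + 1) * s k ^ r * ((eps1 * (1 + C1) + C * C2 * / q) * s k ^ (2 * p))) by ring.
      apply Rmult_le_compat_l; auto. apply Rmult_le_pos; [lra | apply pow_le; lra]. }
  assert (Hsg : poly_growth (fun k => s k ^ (r + 2 * p))).
  { apply poly_growth_pow. unfold s. apply (poly_growth_plus (fun _ => 1));
      [apply poly_growth_const|].
    apply (poly_growth_mult (fun k => Rabs (INR k - INR n * x)) (fun _ => / q));
        [|apply poly_growth_const].
    apply poly_growth_Rabs. apply (poly_growth_plus INR (fun _ => _));
        [apply poly_growth_INR | apply poly_growth_const]. }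
  rewrite nb_mean_der_eq by auto.
  eapply Rle_trans; [apply (nb_mean_Rabs_le _ _ Hc Hg) with (B := fun k => K * s k ^ (r + 2 *
      p)); auto|].
  { apply (poly_growth_mult (fun _ => K)); [apply poly_growth_const | auto]. }
  rewrite nb_mean_scal.
  assert (HEn := HE q ltac:(lra)). rewrite Hqn in HEn. fold s in HEn.
  apply Rle_trans with (K * CE); [now apply Rmult_le_compat_l|].
  assert (X1 : (CQ + 1) * (eps1 * (1 + C1)) * CE = eps / 2).
  { unfold eps1. field. lra. }
  assert (X2 : (CQ + 1) * (C * C2 * / q) * CE <= eps / 2).
  { replace ((CQ + 1) * (C * C2 * / q) * CE) with (((CQ + 1) * CE * (C * C2)) / q) by (field; lra).
    apply <- Rle_div_l; [|lra].
    assert (Hq4 : q4 <= q) by lra. unfold q4 in Hq4. apply -> Rle_div_l in Hq4; [|lra]. nra. }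
  unfold K. nra.
Qed.

(** * The leading term *)

Lemma is_lim_seq_INR_ratio (u v : R) : is_lim_seq (fun n => (INR n + u) / (INR n + v)) 1.
Proof.
  assert (H : is_lim_seq (fun n => 1 + (u - v) * / (INR n + v)) (1 + (u - v) * 0)).
  { apply is_lim_seq_plus'; [apply is_lim_seq_const|].
    apply is_lim_seq_mult'; [apply is_lim_seq_const|].
    replace (Finite 0) with (Rbar_inv p_infty) by reflexivity.
    apply is_lim_seq_inv; [|easy].
    apply is_lim_seq_plus with p_infty (Finite v);
        [apply is_lim_seq_INR | apply is_lim_seq_const | easy]. }
  replace (1 + (u - v) * 0) with 1 in H by ring. revert H. apply is_lim_seq_ext_loc.
  destruct (INR_unbounded (- v)) as [N HN]. exists N. intros n Hn.
  apply le_INR in Hn. field. lra.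
Qed.

(** The centre may vary arbitrarily with n: only the top coefficient in k survives the derivative,
    and it does not involve y. Each factor (n + r g)/(n - r g) tends to 1. *)
Lemma is_lim_seq_nb_mean_der_moment (g x : R) (r : nat) (y : nat -> R) : 0 < g -> 0 < x ->
  is_lim_seq (fun n => nb_mean_der (INR n / g) g r (wmoment (INR n) g (y n) r) x) (INR (fact r)).
Proof.
  intros Hg Hx.
  assert (Hc : forall n, (1 <= n)%nat -> 0 < INR n / g).
  { intros n Hn. apply le_INR in Hn. simpl in Hn. apply Rdiv_lt_0_compat; lra. }
  induction r as [|r IH].
  - apply (is_lim_seq_ext_loc (fun _ => 1)); [|apply is_lim_seq_const].
    exists 1%nat. intros n Hn. symmetry. apply (nb_mean_der_one (INR n / g) g (Hc n Hn) Hg 0 x Hx).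
  - apply (is_lim_seq_ext_loc (fun n => INR (S r) * ((INR n + g * INR r) / (INR n + - (INR r *
      g))) *
       nb_mean_der (INR n / g) g r (wmoment (INR n) g (y n) r) x)).
    + exists 1%nat. intros n Hn. rewrite nb_mean_der_moment_diag by auto.
      replace (g * (INR n / g)) with (INR n) by (field; lra). reflexivity.
    + rewrite fact_simpl, mult_INR.
      replace (Finite (INR (S r) * INR (fact r))) with (Finite (INR (S r) * 1 * INR (fact r)))
          by (f_equal; ring).
      apply is_lim_seq_mult'; auto. apply is_lim_seq_mult';
          [apply is_lim_seq_const | apply is_lim_seq_INR_ratio].
Qed.

Lemma poly_growth_sum (F : nat -> nat -> R) (m : nat) :
  (forall i, poly_growth (F i)) -> poly_growth (fun k => sum_f_R0 (fun i => F i k) m).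
Proof.
  intros H. induction m as [|m IH]; simpl; [apply H | now apply poly_growth_plus].
Qed.

Lemma nb_mean_der_moment_sum (c g N x y : R) (d : nat -> R) (r : nat) : 0 < c -> 0 < g -> 0 < x ->
  nb_mean_der c g (S r) (fun k => sum_f_R0 (fun i => d i * wmoment N g y i k) (S r)) x
  = d (S r) * nb_mean_der c g (S r) (wmoment N g y (S r)) x.
Proof.
  intros Hc Hg Hx.
  assert (G : forall i, poly_growth (fun k => d i * wmoment N g y i k)).
  { intros i. apply (poly_growth_mult (fun _ => _));
      [apply poly_growth_const | apply poly_growth_wmoment]. }
  assert (H0 : forall m, (m <= r)%nat -> nb_mean_der c g (S r) (fun k => sum_f_R0 (fun i => d i *
      wmoment N g y i k) m) x = 0).
  { induction m as [|m IH]; intros Hm.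
    - cbn [sum_f_R0]. rewrite nb_mean_der_scal, nb_mean_der_moment;
        auto using poly_growth_wmoment; [ring | lia].
    - cbn [sum_f_R0]. rewrite nb_mean_der_plus, nb_mean_der_scal, nb_mean_der_moment, IH;
        auto using poly_growth_wmoment; [ring | lia.. |].
      apply (poly_growth_sum (fun i k => d i * wmoment N g y i k)); auto. }
  cbn [sum_f_R0]. rewrite (nb_mean_der_plus c g Hc Hg (S r) (fun k => sum_f_R0 (fun i => d i *
      wmoment N g y i k) r)); auto.
  - rewrite H0, nb_mean_der_scal; auto using poly_growth_wmoment. ring.
  - apply (poly_growth_sum (fun i k => d i * wmoment N g y i k)); auto.
Qed.

Lemma is_weight_sum (n : nat) (g y : R) (d : nat -> R) (m k : nat) :
  0 < g -> 0 < INR n -> INR m * g <= INR n ->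
  is_weight n g k (fun t => sum_f_R0 (fun i => d i * (t - y) ^ i) m)
    (sum_f_R0 (fun i => d i * wmoment (INR n) g y i k) m).
Proof.
  intros Hg Hn. induction m as [|m IH]; intros Hm.
  - apply is_weight_scal, is_weight_wmoment; auto.
  - assert (H := pos_INR m). assert (Hm' := Hm). rewrite S_INR in Hm'.
    cbn [sum_f_R0].
    apply (is_weight_plus n g k (fun t => sum_f_R0 (fun i => d i * (t - y) ^ i) m) (fun t => d (S
        m) * (t - y) ^ S m)).
    + apply IH. nra.
    + apply is_weight_scal, is_weight_wmoment; auto.
Qed.

(** * The operator as a mean, and the limit *)

Definition weight_value (n : nat) (g : R) (h : R -> R) (k : nat) : R :=
  match k with
  | O => h 0
  | S _ => RInt_gen (fun t => b_nkg n k g t * h t) (at_point 0) (Rbar_locally p_infty)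
  end.

(** [RInt_gen] is total, so its value means something only once the integral is known to exist. *)
Lemma is_weight_value (n : nat) (g : R) (h : R -> R) (k : nat) :
  (exists v, is_weight n g k h v) -> is_weight n g k h (weight_value n g h k).
Proof.
  destruct k as [|j]; [reflexivity|]. intros H.
  now apply (RInt_gen_correct (V := R_CompleteNormedModule)).
Qed.

Lemma BDS_nb_mean (n : nat) (g a b : R) (f : R -> R) (y : R) :
  0 < g -> 1 <= INR n / g -> 0 < y ->
  let A := weight_value n g (fun t => f ((INR n * t + a) / (INR n + b))) in
  poly_growth A -> BDS n g a b f y = nb_mean (INR n / g) g A y.
Proof.
  intros Hg Hc Hy A HA. unfold BDS, nb_mean.
  rewrite (Series_incr_1 (fun k => nb_prob (INR n / g) g k y * A k)) by (apply ex_series_nb_mean;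
      auto; lra).
  rewrite Rplus_comm. f_equal.
  - rewrite p_nkg_nb_prob by auto. unfold A, weight_value. now rewrite Rmult_0_r, Rplus_0_l.
  - apply Series_ext. intros j. rewrite p_nkg_nb_prob by auto. reflexivity.
Qed.

Lemma stancu_node_nonneg (n : nat) (a b t : R) : 0 <= a -> 0 <= b -> 0 < INR n -> 0 <= t ->
  0 <= (INR n * t + a) / (INR n + b) <= t + a / INR n.
Proof.
  intros Ha Hb Hn Ht. split.
  - apply Rmult_le_pos; [nra | left; apply Rinv_0_lt_compat; lra].
  - apply Rle_div_l; [lra|].
    replace ((t + a / INR n) * (INR n + b)) with (INR n * t + a + b * (t + a / INR n)) by (field;
        lra).
    assert (0 <= b * (t + a / INR n)); [|lra].
    apply Rmult_le_pos; auto. apply Rplus_le_le_0_compat; auto.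
    apply Rmult_le_pos; [auto | left; now apply Rinv_0_lt_compat].
Qed.

Lemma cont_on_halfline_stancu (n : nat) (a b : R) (f : R -> R) :
  0 <= a -> 0 <= b -> 0 < INR n -> cont_on_halfline f ->
  cont_on_halfline (fun t => f ((INR n * t + a) / (INR n + b))).
Proof.
  intros Ha Hb Hn Hf t Ht.
  set (tau := fun t => (INR n * t + a) / (INR n + b)).
  apply (filterlim_comp _ _ _ tau f _ (within (fun u => 0 <= u) (locally (tau t))));
    [|apply Hf, stancu_node_nonneg; auto].
  assert (Hc : continuous tau t).
  { apply (ex_derive_continuous tau). unfold tau. auto_derive. lra. }
  intros P HP. specialize (Hc _ HP). revert Hc.
  unfold filtermap, within. apply filter_imp. intros u Hu Hu0.
  apply Hu. now apply stancu_node_nonneg.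
Qed.

Theorem theorem1 (g a b mu : R) (r : nat) (f : R -> R) (x l : R) :
  0 < g -> 0 <= a -> a <= b -> 0 < mu -> (1 <= r)%nat ->
  C_mu mu f ->
  0 < x ->
  rth_derivative_at f r x l ->
  exists (D : nat -> R) (N : nat),
    (forall n : nat, (N <= n)%nat ->
        rth_derivative_at (fun y => BDS n g a b f y) r x (D n)) /\
    is_lim_seq D l.
Proof.
  intros Hg Ha Hab Hmu Hr HC Hx Hder. assert (Hb : 0 <= b) by lra.
  destruct r as [|r]; [lia|].
  destruct (C_mu_growth mu f Hmu HC) as [B [m [HB Hgrow]]].
  destruct HC as [Hcont _].
  (* Large enough for three demands: 2p >= m for the growth of f, p >= r for the moment of order 2r,
     and 2p >= r + 1 for the gain 1/q, with r the order of the derivative. *)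
  set (p := (S r + m)%nat).
  destruct (taylor_remainder_bound r m p f x l B Hx HB Hgrow) as [co [Hco Hrem]];
    [unfold p; lia | unfold p; lia | auto |].
  set (h := fun n t => f ((INR n * t + a) / (INR n + b))).
  set (A := fun n => weight_value n g (h n)).
  (* The summands secure in turn n >= 1, n/g >= 1 for [Gamma], convergence for growth of order m,
     and the moments up to the order of the derivative. *)
  destruct (INR_unbounded (1 + g + INR m * g + INR (S r) * g)) as [N HN].
  assert (Hm0 := pos_INR m). assert (Hr0 := pos_INR (S r)).
  assert (HNn : forall n, (N <= n)%nat -> 1 <= INR n /\ 1 <= INR n / g /\ INR m <= INR n / g /\
            INR m * g <= INR n /\ INR (S r) * g <= INR n).
  { intros n Hn. apply le_INR in Hn.
    assert (0 <= INR m * g) by nra. assert (0 <= INR (S r) * g) by nra.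
    repeat split; try lra; apply -> Rle_div_r; lra. }
  assert (Hhgrow : forall n t, 1 <= INR n -> 0 <= t -> Rabs (h n t) <= B * (1 + a) ^ m * (1 + t)
      ^ m).
  { intros n t Hn Ht. destruct (stancu_node_nonneg n a b t) as [H1 H2]; auto; [lra|].
    assert (H3 : a / INR n <= a) by (apply Rle_div_l; [lra | nra]).
    eapply Rle_trans; [apply Hgrow; auto|]. rewrite Rmult_assoc.
    apply Rmult_le_compat_l; auto. rewrite <- Rpow_mult_distr. apply pow_incr. split; [lra|]. nra. }
  assert (HA : forall n, (N <= n)%nat -> forall k, is_weight n g k (h n) (A n k)).
  { intros n Hn k. destruct (HNn n Hn) as [K1 [K2 [K3 [K4 K5]]]].
    apply is_weight_value.
    apply (is_weight_exists n g Hg ltac:(lra) k m (h n) (B * (1 + a) ^ m)); auto.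
    apply cont_on_halfline_stancu; auto. lra. }
  assert (HAg : forall n, (N <= n)%nat -> poly_growth (A n)).
  { intros n Hn. destruct (HNn n Hn) as [K1 [K2 [K3 [K4 K5]]]].
    (* The majorant (1 + t)^m is the power of t - (-1), so its weights are moments about -1, known
       to grow polynomially in k. *)
    apply poly_growth_le with (fun k => B * (1 + a) ^ m * wmoment (INR n) g (-1) m k).
    - intros k. eapply Rle_trans; [|apply Rle_abs].
      assert (HV := is_weight_scal n g k (B * (1 + a) ^ m) _ _ (is_weight_wmoment n g (-1) m k Hg
          ltac:(lra) K4)).
      assert (Hpt : forall t, 0 <= t -> Rabs (h n t) <= B * (1 + a) ^ m * (t - -1) ^ m).
      { intros t Ht. replace (t - -1) with (1 + t) by ring. now apply Hhgrow. }
      apply Rabs_le. split.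
      + assert (H := is_weight_scal n g k (-1) _ _ (HA n Hn k)).
        assert (H1 : -1 * A n k <= B * (1 + a) ^ m * wmoment (INR n) g (-1) m k); [|lra].
        refine (is_weight_le n g Hg ltac:(lra) k _ _ _ _ _ H HV).
        intros t Ht. specialize (Hpt t Ht). apply Rabs_le_between in Hpt. lra.
      + refine (is_weight_le n g Hg ltac:(lra) k _ _ _ _ _ (HA n Hn k) HV).
        intros t Ht. specialize (Hpt t Ht). apply Rabs_le_between in Hpt. lra.
    - apply (poly_growth_mult (fun _ => _)); [apply poly_growth_const | apply
        poly_growth_wmoment]. }
  exists (fun n => nb_mean_der (INR n / g) g (S r) (A n) x), N. split.
  - intros n Hn. destruct (HNn n Hn) as [K1 [K2 _]]. specialize (HAg n Hn).
    assert (Hc : 0 < INR n / g) by lra.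
    (* Level 0 must be the operator itself, which agrees with the mean for y > 0 only; near such y
       the derivative is transferred locally. *)
    set (G := fun j => match j with O => fun y => BDS n g a b f y | S _ => nb_mean_der (INR n /
        g) g j (A n) end).
    assert (HG : forall j y, 0 < y -> is_derive (G j) y (G (S j) y)).
    { intros [|j] y Hy; [|now apply is_derive_nb_mean_der].
      apply (is_derive_ext_loc (nb_mean_der (INR n / g) g 0 (A n)));
          [|now apply (is_derive_nb_mean_der _ _ Hc Hg 0)].
      exists (mkposreal y Hy). intros z Hz. change (Rabs (z - y) < y) in Hz.
      apply Rabs_def2 in Hz. symmetry. apply BDS_nb_mean; auto. lra. }
    exists G, (mkposreal x Hx). split; [reflexivity|]. split; [|now apply (HG r)].
    intros j y _ Hy. simpl in Hy. apply Rabs_def2 in Hy. apply HG. lra.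
  - set (y := fun n => x + (b * x - a) / INR n). set (ka := fun n => INR n / (INR n + b)).
    (* What the Taylor polynomial contributes: about y n its coefficients become co i (ka n)^i, and
       all orders below the top are killed. *)
    set (main := fun n => co (S r) * ka n ^ S r * nb_mean_der (INR n / g) g (S r) (wmoment (INR
        n) g (y n) (S r)) x).
    apply (is_lim_seq_ext (fun n => main n + (nb_mean_der (INR n / g) g (S r) (A n) x - main
        n))); [intros; ring|].
    replace (Finite l) with (Finite (l + 0)) by (f_equal; ring).
    apply is_lim_seq_plus'.
    + replace (Finite l) with (Finite (l / INR (fact (S r)) * 1 * INR (fact (S r))))
        by (f_equal; field; apply INR_fact_neq_0).
      apply is_lim_seq_mult'; [|now apply is_lim_seq_nb_mean_der_moment].
      rewrite Hco. apply is_lim_seq_mult'; [apply is_lim_seq_const|].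
      assert (Hka : is_lim_seq ka 1).
      { apply (is_lim_seq_ext (fun n => (INR n + 0) / (INR n + b))); [|apply is_lim_seq_INR_ratio].
        intros n. now rewrite Rplus_0_r. }
      generalize (S r). intros i. induction i as [|i IH]; [apply is_lim_seq_const|].
      replace (Finite 1) with (Finite (1 * 1)) by (f_equal; ring).
      now apply (is_lim_seq_mult' ka (fun n => ka n ^ i)).
    + apply is_lim_seq_spec. intros eps.
      destruct (remainder_der_bound g a b x (S r) p
        (fun t => f t - sum_f_R0 (fun i => co i * (t - x) ^ i) (S r)) Hg Ha Hb Hx ltac:(unfold p;
            lia) ltac:(unfold p; lia)
        Hrem (eps / 2)) as [N' HN']; [destruct eps; simpl; lra|].
      exists (max N N'). intros n Hn.
      destruct (HNn n ltac:(lia)) as [K1 [K2 [K3 [K4 K5]]]].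
      (* The weights of the Taylor polynomial at the Stancu node. Then A n - P are those of the
         remainder, to which [remainder_der_bound] applies. *)
      set (P := fun k => sum_f_R0 (fun i => co i * ka n ^ i * wmoment (INR n) g (y n) i k) (S r)).
      assert (HP : forall k, is_weight n g k (fun t => sum_f_R0 (fun i => co i * ka n ^ i * (t -
          y n) ^ i) (S r)) (P k)).
      { intros k. apply (is_weight_sum n g (y n) (fun i => co i * ka n ^ i)); auto. lra. }
      assert (HPg : poly_growth P).
      { apply (poly_growth_sum (fun i k => co i * ka n ^ i * wmoment (INR n) g (y n) i k)).
        intros i. apply (poly_growth_mult (fun _ => _));
            [apply poly_growth_const | apply poly_growth_wmoment]. }
      assert (HPg' : poly_growth (fun k => -1 * P k))
        by (apply (poly_growth_mult (fun _ => _)); [apply poly_growth_const | auto]).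
      specialize (HAg n ltac:(lia)). specialize (HA n ltac:(lia)).
      specialize (HN' n ltac:(lia) (fun k => A n k + -1 * P k)).
      rewrite Rminus_0_r.
      replace (nb_mean_der (INR n / g) g (S r) (A n) x - main n)
        with (nb_mean_der (INR n / g) g (S r) (fun k => A n k + -1 * P k) x).
      * eapply Rle_lt_trans; [apply HN'|destruct eps; simpl; lra].
        intros k. apply (is_weight_ext n g k (fun t => h n t + -1 * sum_f_R0 (fun i => co i * ka
            n ^ i * (t - y n) ^ i) (S r))).
        -- intros t Ht. unfold h.
           replace ((INR n * t + a) / (INR n + b) - x) with (ka n * (t - y n))
             by (unfold ka, y; field; lra).
           rewrite (sum_eq (fun i => co i * ka n ^ i * (t - y n) ^ i) (fun i => co i * (ka n * (t
               - y n)) ^ i));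
             [ring | intros i _; rewrite Rpow_mult_distr; ring].
        -- apply is_weight_plus; auto. now apply is_weight_scal.
      * rewrite nb_mean_der_plus, nb_mean_der_scal by (auto; lra).
        unfold P. rewrite (nb_mean_der_moment_sum (INR n / g) g (INR n) x (y n) (fun i => co i *
            ka n ^ i)) by lra.
        unfold main. ring.
Qed.
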